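(* Let $E$ be a locally complete locally convex Hausdorff space over $\mathbb{C}$ and $\Omega\subset\mathbb{C}^{d}$ open. Then the following statements are equivalent for a function $f\colon\Omega\to E$. a) $f$ is holomorphic on $\Omega$. b) $f\in\mathcal{O}(\Omega,E)$.
   Context: $E$ is a non-trivial locally convex Hausdorff space with completion $\widehat{E}$. For a bounded, absolutely convex set (disk) $D\subset E$ put $E_D:=\bigcup_{n\in\mathbb{N}}nD$ normed by the gauge of $D$; $E$ is locally complete if $E_D$ is a Banach space for every closed disk $D$. $f\colon\Omega\to E$ is holomorphic if for every $z\in\Omega$ there is a $\mathbb{C}$-linear map $df(z)\colon\mathbb{C}^d\to\widehat{E}$ with $\lim_{w\to z,\,w\in\Omega,\,w\ne z}\frac{f(w)-f(z)-df(z)[w-z]}{|w-z|}=0$ in $\widehat{E}$, and $df(\cdot)[v]\colon\Omega\to\widehat{E}$ is continuous for every $v\in\mathbb{C}^d$. $(\partial^{e_j}_{\mathbb{C}})^{E}f(z):=\lim_{h\to0,\,h\in\mathbb{C}\setminus\{0\}}\frac{f(z+he_j)-f(z)}{h}$ if the limit exists in $E$ ($e_j$ the $j$th unit vector). For $\beta\in\mathbb{N}_0^d$, $(\partial^{\beta}_{\mathbb{C}})^{E}f:=(\partial^{\beta_1}_{\mathbb{C}})\cdots(\partial^{\beta_d}_{\mathbb{C}})f$, where $\partial^{\beta_j}_{\mathbb{C}}$ is the $\beta_j$-fold iterate of $(\partial^{e_j}_{\mathbb{C}})^E$. $f\in\mathcal{D}^{1}_{\mathbb{C}}(\Omega,E)$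 means that $(\partial^{e_j}_{\mathbb{C}})^Ef(z)$ exists in $E$ for all $z\in\Omega$ and $1\le j\le d$; $f\in\mathcal{D}^{k}_{\mathbb{C}}(\Omega,E)$ ($k\ge2$) means $f\in\mathcal{D}^1_{\mathbb{C}}(\Omega,E)$ and all first complex partial derivatives are in $\mathcal{D}^{k-1}_{\mathbb{C}}(\Omega,E)$. Requiring $(\partial^{\beta}_{\mathbb{C}})^{E}f(z)\in E$ for all $\beta\in\mathbb{N}_0^d$ and $z\in\Omega$ means that all complex partial derivatives of all orders exist in $E$ in this sense, i.e. $f\in\mathcal{D}^k_{\mathbb{C}}(\Omega,E)$ for all $k$. With $\phi\colon\mathbb{C}^d\to\mathbb{R}^{2d}$, $\phi(z)=(\operatorname{Re}z_1,\operatorname{Im}z_1,\dots,\operatorname{Re}z_d,\operatorname{Im}z_d)$, $\mathcal{C}^{1}_{\mathbb{R}}(\Omega,E)$ is the set of $f\colon\Omega\to E$ such that $f\circ\phi^{-1}$ is continuously partially differentiable on $\phi(\Omega)$ with values in $E$. Finally \[ \mathcal{O}(\Omega,E):=\{f\in\mathcal{C}^{1}_{\mathbb{R}}(\Omega,E)\mid \forall\,\beta\in\mathbb{N}_0^d,\ z\in\Omega:\ (\partial^{\beta}_{\mathbb{C}})^{E}f(z)\in E\}. \] *)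

(* Defs.v *)
From HB Require Import structures.
From mathcomp Require Import all_boot all_order all_algebra.
From mathcomp Require Import complex.
From mathcomp Require Import boolp classical_sets functions reals topology normedtype.

Set Implicit Arguments.
Unset Strict Implicit.
Unset Printing Implicit Defensive.

Import Order.TTheory GRing.Theory Num.Theory.
Import numFieldNormedType.Exports.

Local Open Scope classical_set_scope.
Local Open Scope ring_scope.
Local Open Scope complex_scope.

(* R[i] carries the topology of its modulus, as any numClosedFieldType. *)
HB.instance Definition _ (R : rcfType) := GRing.ComAlgebra.copy R[i] R[i]^o.
HB.instance Definition _ (R : rcfType) := Vector.copy R[i] R[i]^o.
HB.instance Definition _ (R : rcfType) := NormedModule.copy R[i] R[i]^o.

Section LocallyConvex.
Context {R : realType}.
Implicit Type E : tvsType R[i].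

(* The uniformity bundled in a [tvsType] is only required to induce the
   topology, hence boundedness and completeness are phrased with the
   neighbourhoods of 0, i.e. with the translation-invariant uniformity. *)

Definition tvs_bounded {E} (D : set E) : Prop :=
  forall U : set E, nbhs 0 U ->
    exists2 r : R, 0 < r & D `<=` [set r%:C *: y | y in U].

Definition absolutely_convex {E} (D : set E) : Prop :=
  D !=set0 /\
  forall (x y : E) (a b : R[i]), D x -> D y -> `|a| + `|b| <= 1 ->
    D (a *: x + b *: y).

Definition disk {E} (D : set E) : Prop := tvs_bounded D /\ absolutely_convex D.

Definition disk_span {E} (D : set E) : set E :=
  \bigcup_(n : nat) [set n%:R *: y | y in D].

Definition gauge {E} (D : set E) (x : E) : R :=
  inf [set t : R | 0 < t /\ exists2 y, D y & x = t%:C *: y].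

(* In a Hausdorff space the gauge of a disk D is a norm on [disk_span D], so
   being a Banach space amounts to completeness for this norm. *)
Definition disk_span_banach {E} (D : set E) : Prop :=
  forall u : nat -> E, (forall n, disk_span D (u n)) ->
    (forall e : R, 0 < e -> exists N : nat, forall m n : nat,
      (N <= m)%N -> (N <= n)%N -> gauge D (u m - u n) < e) ->
    exists2 l : E, disk_span D l & gauge D (u n - l) @[n --> \oo] --> (0 : R).

Definition locally_complete E : Prop :=
  forall D : set E, closed D -> disk D -> disk_span_banach D.

Definition tvs_cauchy {E} (F : set_system E) : Prop :=
  xy.1 - xy.2 @[xy --> (F, F)] --> (0 : E).

Definition tvs_complete E : Prop :=
  forall F : set_system E, ProperFilter F -> tvs_cauchy F ->
    exists l : E, F --> l.

Record completion E := Completion {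
  cpl_space :> tvsType R[i] ;
  cpl_inj : {linear E -> cpl_space} ;
  cpl_hausdorff : hausdorff_space cpl_space ;
  cpl_complete : tvs_complete cpl_space ;
  cpl_injective : injective cpl_inj ;
  cpl_initial : forall (x : E) (U : set E),
    nbhs x U <-> exists2 V, nbhs (cpl_inj x) V & cpl_inj @^-1` V `<=` U ;
  cpl_dense : dense (range cpl_inj)
}.

End LocallyConvex.

(* A function f : Omega -> E is represented by a total function whose values
   outside the open set Omega are irrelevant. *)
Section Holomorphy.
Context {R : realType} {d : nat} {E : tvsType R[i]}.
Implicit Types (Omega : set 'rV[R[i]]_d) (f : 'rV[R[i]]_d -> E).

Definition enorm (v : 'rV[R[i]]_d) : R[i] := sqrtC (\sum_j `|v 0 j| ^+ 2).

Definition holomorphic (Ehat : completion E) Omega f : Prop :=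
  exists df : 'rV[R[i]]_d -> {linear 'rV[R[i]]_d -> Ehat},
    (forall z, Omega z ->
      (enorm (w - z))^-1 *:
        (cpl_inj Ehat (f w) - cpl_inj Ehat (f z) - df z (w - z))
      @[w --> within Omega z^'] --> (0 : Ehat)) /\
    (forall v, {within Omega, continuous (fun z => df z v)}).

Definition cquotient f (z : 'rV[R[i]]_d) (j : 'I_d) (h : R[i]) : E :=
  h^-1 *: (f (z + h *: delta_mx 0 j) - f z).

(* Junk value 0 where the limit does not exist. *)
Definition cpartial (j : 'I_d) f (z : 'rV[R[i]]_d) : E :=
  xget 0 [set l : E | cquotient f z j h @[h --> 0^'] --> l].

Definition cdiff1 Omega f : Prop :=
  forall z, Omega z -> forall j : 'I_d,
    exists l : E, cquotient f z j h @[h --> 0^'] --> l.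

(* k complex derivatives; the case k = 0 imposes nothing *)
Fixpoint cdiff (k : nat) Omega f : Prop :=
  if k is k'.+1 then
    cdiff1 Omega f /\ forall j : 'I_d, cdiff k' Omega (cpartial j f)
  else True.

(* [mxvec] is row-major: phi z = (Re z_1, Im z_1, ..., Re z_d, Im z_d). *)
Definition phi (z : 'rV[R[i]]_d) : 'rV[R]_(d * 2) :=
  mxvec (\matrix_(j < d, b < 2)
    if b == 0 then complex.Re (z 0 j) else complex.Im (z 0 j)).

Definition phi_inv (x : 'rV[R]_(d * 2)) : 'rV[R[i]]_d :=
  \row_j (vec_mx x j 0 +i* vec_mx x j 1).

Lemma phiK : cancel phi phi_inv.
Proof.
by move=> z; apply/rowP => j; rewrite /phi mxE mxvecK !mxE /=; case: (z 0 j).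
Qed.

Lemma phi_invK : cancel phi_inv phi.
Proof.
move=> x; rewrite /phi -[RHS]vec_mxK; congr mxvec; apply/matrixP => j b.
rewrite !mxE /=; case: eqP => [->|b0] /=; rewrite ?mxE //.
suff -> : b = 1 by [].
by apply/val_inj; case: b b0 => -[|[|[]]] //= b2 /eqP.
Qed.

Definition rquotient (g : 'rV[R]_(d * 2) -> E) (x : 'rV[R]_(d * 2))
    (i : 'I_(d * 2)) (t : R) : E :=
  (t%:C)^-1 *: (g (x + t *: delta_mx 0 i) - g x).

Definition rpartial (i : 'I_(d * 2)) (g : 'rV[R]_(d * 2) -> E)
    (x : 'rV[R]_(d * 2)) : E :=
  xget 0 [set l : E | rquotient g x i t @[t --> 0^'] --> l].

Definition cont_partially_diff (A : set 'rV[R]_(d * 2))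
    (g : 'rV[R]_(d * 2) -> E) : Prop :=
  forall i : 'I_(d * 2),
    (forall x, A x -> exists l : E, rquotient g x i t @[t --> 0^'] --> l) /\
    {within A, continuous (rpartial i g)}.

Definition C1_real Omega f : Prop :=
  cont_partially_diff (phi @` Omega) (f \o phi_inv).

Definition O_space Omega : set ('rV[R[i]]_d -> E) :=
  [set f | C1_real Omega f /\ forall k : nat, cdiff k Omega f].

End Holomorphy.

(* Main.v *)
From HB Require Import structures.
Require Import Defs.
From mathcomp Require Import all_boot all_order all_algebra.
From mathcomp Require Import complex.
From mathcomp Require Import boolp classical_sets functions reals topology normedtype.
From mathcomp Require Import convex interval_inference ring lra.
Import Order.TTheory GRing.Theory Num.Theory.
Import numFieldNormedType.Exports.
Local Open Scope classical_set_scope.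
Local Open Scope ring_scope.
Local Open Scope complex_scope.
Set Implicit Arguments.
Unset Strict Implicit.
Unset Printing Implicit Defensive.

(** Both conditions are compared with a third one, [complex_C1]: the complex
    partial derivatives of first order exist and are continuous. All estimates are
    made with continuous seminorms, which define the topology ([csn_base]).

    A function in [O_space] is complex C^1 in [E], because its
    complex partial derivatives are some of its continuous real ones. The mean
    value inequality ([line_mean_value]) then makes it totally differentiable
    ([complex_C1_total]), hence holomorphic.

    Conversely, let [f] be holomorphic. Composed with the embedding into the
    completion it is complex C^1 ([holomorphic_complex_C1]), with derivatives that
    a priori lie in the completion only. The core is a form of Cauchy's theory
    for functions with values in a locally convex space that avoids integrals and
    linear functionals. The mean over a regular polygon inscribed in a circle
    replaces the contour integral: complex differentiability turns its variation
    with the radius into a telescoping sum around the polygon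
    ([radial_increment]). This gives a maximum principle at the centre of a disc
    ([max_at_centre]), which, applied to a difference quotient, is Cauchy's
    estimate ([cauchy_estimate]). That estimate, applied to differences of
    difference quotients, shows that in a complete space the partial derivatives
    of a complex C^1 function are again complex C^1 ([complex_C1_cpartial]).

    The derivatives belong to [E] itself for the following reason. Since the
    derivative in the completion is differentiable, the difference quotients of
    [f] with steps [2^-n] converge with speed [2^-n] for every seminorm; such a
    sequence is a Cauchy sequence in the normed space of a closed disk, so local
    completeness gives its limit in [E] ([mackey_cvg],
    [complex_C1_cquotient_cvg]). Iterating yields all derivatives
    ([complex_C1_cdiff]), and continuity of those of first order gives the
    continuity of the real partial derivatives ([complex_C1_C1_real]). *)

(** * Complex modulus and neighbourhoods *)

Section Modulus.
Context {R : realType}.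


(** The modulus with values in [R]: estimates are carried out there, because the
    order of [R[i]] is only partial. *)
Definition cnorm (z : R[i]) : R := Normc.normc z.

Lemma normr_cnorm (z : R[i]) : `|z| = ((cnorm z)%:C)%C.
Proof. by case: z => a b; rewrite normc_def. Qed.

Lemma cnorm_ge0 (z : R[i]) : 0 <= cnorm z.
Proof. by case: z => a b; exact: sqrtr_ge0. Qed.

Lemma cnormM (z w : R[i]) : cnorm (z * w) = cnorm z * cnorm w.
Proof. exact: Normc.normcM. Qed.

Lemma cnormD (z w : R[i]) : cnorm (z + w) <= cnorm z + cnorm w.
Proof. exact: le_normcD. Qed.

Lemma cnormN (z : R[i]) : cnorm (- z) = cnorm z.
Proof. exact: normcN. Qed.

Lemma cnorm0 : cnorm 0 = 0.
Proof. exact: Normc.normc0. Qed.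

Lemma cnorm1 : cnorm 1 = 1.
Proof. exact: Normc.normc1. Qed.

Lemma cnorm_distC (z w : R[i]) : cnorm (z - w) = cnorm (w - z).
Proof. by rewrite -cnormN opprB. Qed.

Lemma cnormV (z : R[i]) : cnorm z^-1 = (cnorm z)^-1.
Proof. exact: Normc.normcV. Qed.

Lemma cnorm_eq0 (z : R[i]) : (cnorm z == 0) = (z == 0).
Proof.
apply/eqP/eqP => [|->]; last exact: cnorm0.
exact: Normc.eq0_normc.
Qed.

Lemma cnorm_gt0 (z : R[i]) : (0 < cnorm z) = (z != 0).
Proof. by rewrite lt_def cnorm_ge0 andbT cnorm_eq0. Qed.

Lemma cnorm_real (x : R) : cnorm (x%:C)%C = `|x|.
Proof. by rewrite /cnorm /= expr0n /= addr0 sqrtr_sqr. Qed.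

Lemma cnormX (z : R[i]) n : cnorm (z ^+ n) = cnorm z ^+ n.
Proof. by elim: n => [|n IH]; rewrite ?cnorm1// !exprS cnormM IH. Qed.

Lemma cnorm_triangle (z w u : R[i]) : cnorm (z - w) <= cnorm (z - u) + cnorm (u - w).
Proof. by rewrite -(subrKA u z (- w)) cnormD. Qed.

Lemma realC_neq0 (x : R) : 0 < x -> (x%:C)%C != 0 :> R[i].
Proof. by move=> x0; rewrite eq_complex /= negb_and gt_eqF. Qed.

Lemma nbhs_cnorm (z : R[i]) (P : set R[i]) :
  nbhs z P <-> exists2 r : R, 0 < r & forall w, cnorm (w - z) < r -> P w.
Proof.
split.
  move=> /nbhs_normP[[a b]] /=; rewrite /ball_ /= ltcE /= => /andP[/eqP -> a0 H].
  exists a => // w wz; apply: H => /=.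
  by rewrite normr_cnorm cnorm_distC ltcE/= eqxx.
move=> [r r0 H]; apply/nbhs_normP; exists (r%:C)%C => /=.
  by rewrite ltcR.
by move=> w /=; rewrite /ball_ /= normr_cnorm ltcR cnorm_distC => /H.
Qed.

Lemma dnbhs_cnorm (P : set R[i]) :
  (0 : R[i])^' P <-> exists2 r : R, 0 < r & forall w, w != 0 -> cnorm w < r -> P w.
Proof.
split.
  by move=> /nbhs_cnorm[r r0 H]; exists r => // w w0 wr; apply: H; rewrite ?subr0.
move=> [r r0 H]; apply/nbhs_cnorm; exists r => // w; rewrite subr0 => wr w0.
exact: H.
Qed.

Lemma nbhs_row d (z : 'rV[R[i]]_d) (P : set 'rV[R[i]]_d) :
  nbhs z P <-> exists2 r : R, 0 < r &
    forall w : 'rV[R[i]]_d, (forall j, cnorm (w 0 j - z 0 j) < r) -> P w.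
Proof.
split.
  move=> /nbhs_ballP[[a b]] /=; rewrite ltcE /= => /andP[/eqP -> a0 H].
  exists a => // w wz; apply: H.
  split => [|i j]; first by rewrite ltcE/= eqxx.
  by rewrite ord1 -ball_normE /ball_ /= normr_cnorm cnorm_distC ltcE/= eqxx wz.
move=> [r r0 H]; apply/nbhs_ballP; exists (r%:C)%C => /=.
  by rewrite ltcR.
move=> w [_ wz]; apply: H => j; have := wz 0 j.
by rewrite -ball_normE /ball_ /= normr_cnorm ltcR cnorm_distC.
Qed.

End Modulus.

(** * Continuous seminorms *)

(** Continuity at 0 suffices, since a seminorm satisfies
    [|p x - p y| <= p (x - y)]. *)
Record cseminorm (R : realType) (E : tvsType R[i]) := CSeminorm {
  csn_fun :> E -> R ;
  csnD : forall x y, csn_fun (x + y) <= csn_fun x + csn_fun y ;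
  csnZ : forall a x, csn_fun (a *: x) = cnorm a * csn_fun x ;
  csn_nbhs : forall e, 0 < e -> nbhs 0 [set x | csn_fun x < e] }.

Section CSnTheory.
Context {R : realType} {E : tvsType R[i]}.
Implicit Type p : cseminorm E.

Lemma csn0 p : p 0 = 0.
Proof. by rewrite -(scale0r (0 : E)) csnZ cnorm0 mul0r. Qed.

Lemma csnN p x : p (- x) = p x.
Proof. by rewrite -scaleN1r csnZ cnormN cnorm1 mul1r. Qed.

Lemma csn_ge0 p x : 0 <= p x.
Proof.
by have := csnD p x (- x); rewrite subrr csn0 csnN -mulr2n pmulrn_lge0.
Qed.

Lemma csn_distC p x y : p (x - y) = p (y - x).
Proof. by rewrite -csnN opprB. Qed.

Lemma csnB p x y : p (x - y) <= p x + p y.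
Proof. by rewrite -(csnN p y) csnD. Qed.

Lemma csn_triangle p y x z : p (x - z) <= p (x - y) + p (y - z).
Proof. by rewrite -(subrKA y x (- z)) csnD. Qed.

Lemma csn_sum p (I : Type) (r : seq I) (P : pred I) (F : I -> E) :
  p (\sum_(i <- r | P i) F i) <= \sum_(i <- r | P i) p (F i).
Proof.
elim/big_ind2 : _ => [|x u y v xu yv|//]; first by rewrite csn0.
by rewrite (le_trans (csnD _ _ _))// lerD.
Qed.

Lemma csn_nbhs_at p x e : 0 < e -> nbhs x [set y | p (y - x) < e].
Proof.
move=> /(csn_nbhs p)/(nbhsT x); apply: filterS => _ /= [y pye <-].
by rewrite addrC addKr.
Qed.

Lemma absconv_scale (B : set E) (s : R) x : absolutely_convex B ->
  0 <= s <= 1 -> B x -> B ((s%:C)%C *: x).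
Proof.
move=> [_ cB] /andP[s0 s1] Bx.
rewrite -[_ *: x]addr0 -(scale0r x); apply: cB => //.
by rewrite normr0 addr0 normr_cnorm cnorm_real ger0_norm// lecR.
Qed.

(** The infimum defining the gauge need not be attained, but every larger radius is
    admissible: absolutely convex sets shrink under scalars in [[0, 1]]. *)
Lemma gauge_lt (B : set E) x (t : R) : absolutely_convex B ->
  gauge B x < t -> (exists2 s, 0 < s & exists2 y, B y & x = (s%:C)%C *: y) ->
  exists2 y, B y & x = (t%:C)%C *: y.
Proof.
move=> cB xt [s0 s00 [y0 By0 xy0]].
set S := [set t : R | 0 < t /\ exists2 y, B y & x = t%:C%C *: y].
have hS : has_inf S.
  split; first by exists s0; split => //; exists y0.
  by exists 0 => s [/ltW].
have [s [s_gt0 [y By ->]] st] : exists2 s, S s & s < t.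
  by apply: inf_lt => //; case: hS.
have t0 : 0 < t := lt_trans s_gt0 st.
exists (((s / t)%:C)%C *: y).
  apply: absconv_scale => //.
  by apply/andP; split; [rewrite divr_ge0 ?ltW|rewrite ler_pdivrMr// mul1r ltW].
rewrite scalerA -rmorphM/=; congr (_%:C%C *: _).
by rewrite mulrCA divff ?mulr1// gt_eqF.
Qed.

Lemma gauge_le (B : set E) y (t : R) : 0 < t -> B y ->
  gauge B (t%:C%C *: y) <= t.
Proof.
move=> t0 By; apply: ge_inf; last by split => //; exists y.
by exists 0 => s [/ltW].
Qed.


Lemma convex_set_combination (b : set E) (x y : E) (s t : R) : convex_set b ->
  0 <= s -> 0 <= t -> s + t = 1 -> b x -> b y ->
  b (s%:C *: x + t%:C *: y).
Proof.
move=> cb s0 t0 st1 bx yb.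
have s0' : 0 <= (s%:C : R[i]) by rewrite ler0c.
have s1' : (s%:C : R[i]) <= 1 by rewrite lecR -st1 lerDl.
have : b (s%:C *: x + (1 - s%:C) *: y).
  exact: (set_mem (cb x y (Itv01 s0' s1') (mem_set bx) (mem_set yb))).
by have -> : t = 1 - s by [lra]; rewrite rmorphB rmorph1.
Qed.

Lemma convex_set_subcombination (b : set E) (x y : E) (s t : R) : convex_set b -> b 0 ->
  0 <= s -> 0 <= t -> s + t <= 1 -> b x -> b y ->
  b (s%:C *: x + t%:C *: y).
Proof.
move=> cb b0 s0 t0 st1 bx yb.
have [st0|st0] := eqVneq (s + t) 0.
  have [-> ->] : s = 0 /\ t = 0 by split; lra.
  by rewrite !scale0r addr0.
have stp : 0 < s + t by rewrite lt_def st0 addr_ge0.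
have bz : b ((s / (s + t))%:C *: x + (t / (s + t))%:C *: y).
  by apply: convex_set_combination; rewrite -?mulrDl ?divff// divr_ge0// ltW.
rewrite [X in b X](_ : _ = (s + t)%:C *:
  ((s / (s + t))%:C *: x + (t / (s + t))%:C *: y) + (1 - (s + t))%:C *: 0).
  by apply: convex_set_combination => //; [exact: ltW|lra|lra].
rewrite scaler0 addr0 scalerDr !scalerA -!rmorphM/=.
by congr (_%:C *: _ + _%:C *: _); rewrite mulrCA divff ?mulr1.
Qed.

(** Local convexity provides convex neighbourhoods of 0, which need not be
    balanced. The largest balanced subset of a convex set is still convex, and it
    is stable under complex coefficients because a scalar is its modulus times a
    unimodular factor, which the core absorbs. *)
Lemma balanced_core_absolutely_convex (b : set E) : convex_set b -> b 0 ->
  absolutely_convex [set x : E | forall a : R[i], cnorm a <= 1 -> b (a *: x)].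
Proof.
move=> cb b0; split; first by exists 0 => a _; rewrite scaler0.
move=> x y a c Dx Dy ac1 u u1 /=.
have polar (w : R[i]) z : (forall a : R[i], cnorm a <= 1 -> b (a *: z)) ->
    exists2 z', b z' & w *: z = (cnorm w)%:C *: z'.
  move=> Dz; have [->|w0] := eqVneq w 0.
    by exists 0 => //; rewrite scale0r scaler0.
  have mw0 : (cnorm w)%:C != 0 :> R[i].
    by rewrite realC_neq0 ?cnorm_gt0.
  exists (((cnorm w)%:C)^-1 * w *: z); last by rewrite scalerA mulVKf.
  apply: Dz; rewrite cnormM cnormV cnorm_real ger0_norm ?cnorm_ge0// mulVf//.
  by rewrite cnorm_eq0.
have [x' bx xE] := polar (u * a) x Dx.
have [y' yb yE] := polar (u * c) y Dy.
rewrite scalerDr !scalerA xE yE.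
apply: convex_set_subcombination => //; rewrite ?cnorm_ge0//.
rewrite !cnormM -mulrDr; rewrite !normr_cnorm -rmorphD lecR in ac1.
by rewrite mulr_ile1// ?cnorm_ge0// addr_ge0 ?cnorm_ge0.
Qed.

(** The gauge of an absolutely convex neighbourhood of 0 is a continuous seminorm:
    such a set absorbs every point since [a *: x] tends to 0 with [a]. *)
Lemma gauge_csn (B : set E) : absolutely_convex B -> nbhs 0 B ->
  exists2 p : cseminorm E, csn_fun p = gauge B &
    forall x t, p x < t -> exists2 y, B y & x = t%:C *: y.
Proof.
move=> cB nB.
have abso x : exists2 s : R, 0 < s & exists2 y, B y & x = s%:C *: y.
  have := @scale_continuous R[i] E (0, x) B; rewrite /= scale0r => /(_ nB).
  move=> [[A1 A2] /= [/nbhs_cnorm[r r0 A1r] nA2] AB].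
  exists (r / 2)^-1; first by rewrite invr_gt0 divr_gt0.
  exists ((r / 2)%:C *: x); last first.
    by rewrite scalerA -rmorphM mulVf ?scale1r// gt_eqF// divr_gt0.
  apply: (AB ((r / 2)%:C, x)); split => /=; last exact: nbhs_singleton.
  by apply: A1r; rewrite subr0 cnorm_real gtr0_norm ?divr_gt0//; lra.
have ex x e : 0 < e -> exists2 y, B y & x = (gauge B x + e)%:C *: y.
  by move=> e0; apply: gauge_lt => //; rewrite ltrDl.
have g0 x : 0 <= gauge B x.
  apply: lb_le_inf; last by move=> s [/ltW].
  by have [s s0 sy] := abso x; exists s.
have le_eps (x y : R) : (forall e, 0 < e -> x <= y + e) -> x <= y.
  by move=> H; apply/ler_addgt0Pr.
have gZ a x : gauge B (a *: x) <= cnorm a * gauge B x.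
  have [->|a0] := eqVneq a 0.
    rewrite scale0r cnorm0 mul0r; apply: le_eps => e e0; rewrite add0r.
    have B0 : B 0 by exact: nbhs_singleton.
    by have := gauge_le e0 B0; rewrite scaler0.
  have ma0 : 0 < cnorm a by rewrite cnorm_gt0.
  apply: le_eps => e e0.
  have [y By {1}->] := ex x (e / cnorm a) (divr_gt0 e0 ma0).
  have uB : B ((a / (cnorm a)%:C) *: y).
    rewrite -[X in B X]addr0 -(scale0r y); case: (cB) => _; apply => //.
    rewrite normr0 addr0 normr_cnorm cnormM cnormV cnorm_real ger0_norm ?cnorm_ge0//.
    by rewrite divff ?gt_eqF.
  rewrite scalerA [X in gauge B X](_ : _ =
      (cnorm a * (gauge B x + e / cnorm a))%:C *: ((a / (cnorm a)%:C) *: y)).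
    rewrite (le_trans (gauge_le _ uB))//.
      by rewrite mulr_gt0// ltr_wpDl// divr_gt0.
    by rewrite mulrDr [cnorm a * (e / _)]mulrCA divff ?mulr1 ?gt_eqF.
  rewrite scalerA rmorphM; congr (_ *: _).
  have : (cnorm a)%:C != 0 :> R[i].
    exact: realC_neq0.
  by move=> h; field.
have gZE a x : gauge B (a *: x) = cnorm a * gauge B x.
  have [->|a0] := eqVneq a 0.
    by apply/eqP; rewrite eq_le gZ cnorm0 mul0r g0.
  apply/eqP; rewrite eq_le gZ/=.
  have ma0 : 0 < cnorm a by rewrite cnorm_gt0.
  rewrite mulrC -ler_pdivlMr// mulrC -cnormV.
  by have := gZ a^-1 (a *: x); rewrite scalerA mulVf// scale1r.
have gD x y : gauge B (x + y) <= gauge B x + gauge B y.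
  apply: le_eps => e e0.
  have e20 : 0 < e / 2 by rewrite divr_gt0.
  have [x' Bx {1}->] := ex x _ e20; have [y' By {1}->] := ex y _ e20.
  set s := gauge B x + _; set t := gauge B y + _.
  have s0 : 0 < s by rewrite ltr_wpDl.
  have t0 : 0 < t by rewrite ltr_wpDl.
  have st0 : 0 < s + t by exact: addr_gt0.
  have Bxy : B ((s / (s + t))%:C *: x' + (t / (s + t))%:C *: y').
    case: (cB) => _; apply => //; rewrite !normr_cnorm !cnorm_real -rmorphD lecR.
    by rewrite !gtr0_norm ?divr_gt0// -mulrDl divff ?gt_eqF.
  rewrite [X in gauge B X](_ : _ = (s + t)%:C *:
     ((s / (s + t))%:C *: x' + (t / (s + t))%:C *: y')).
    by rewrite (le_trans (gauge_le _ Bxy))// /s /t; lra.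
  rewrite scalerDr !scalerA -!rmorphM/=.
  by congr (_%:C *: _ + _%:C *: _); rewrite mulrCA divff ?mulr1// gt_eqF.
have gN e : 0 < e -> nbhs 0 [set x | gauge B x < e].
  move=> e0; have e20 : 0 < e / 2 by rewrite divr_gt0.
  have h : (e / 2)%:C != 0 :> R[i].
    exact: realC_neq0.
  apply: filterS (nbhs0Z h nB) => _ /= [y By <-].
  by rewrite (le_lt_trans (gauge_le e20 By))//; lra.
by exists (CSeminorm gD gZE gN) => // x t /gauge_lt; apply.
Qed.

(** Local convexity enters here, through the gauges of balanced cores. *)
Lemma csn_base (U : set E) : nbhs 0 U ->
  exists p : cseminorm E, [set x | p x < 1] `<=` U.
Proof.
move=> nU; have [B cB [oB fB]] := @locally_convex R[i] E.
have [b [Bb b0] bU] := fB 0 U nU.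
have cb : convex_set b by exact/cB/mem_set.
have nb : nbhs 0 b by apply: open_nbhs_nbhs; split => //; exact: oB.
pose K := [set x : E | forall a : R[i], cnorm a <= 1 -> b (a *: x)].
have cK : absolutely_convex K by exact: balanced_core_absolutely_convex.
have nK : nbhs 0 K.
  have := @scale_continuous R[i] E (0, 0) b; rewrite /= scale0r => /(_ nb).
  move=> [[A1 A2] /= [/nbhs_cnorm[r r0 A1r] nA2] AB].
  have r20 : 0 < r / 2 by rewrite divr_gt0.
  have h : (r / 2)%:C != 0 :> R[i].
    exact: realC_neq0.
  apply: filterS (nbhs0Z h nA2) => _ /= [y A2y <-] a a1.
  rewrite scalerA; apply: (AB (a * (r / 2)%:C, y)); split => //=.
  apply: A1r; rewrite subr0 cnormM cnorm_real gtr0_norm//.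
  by rewrite (le_lt_trans (ler_wpM2r (ltW r20) a1))//; lra.
have [p _ pK] := gauge_csn cK nK; exists p => x /pK[y Ky ->].
by apply: bU; apply: Ky; rewrite cnorm_real normr1.
Qed.

End CSnTheory.

(** * The mean value inequality *)

(** Mean value inequality for a pseudometric on a segment: a local Lipschitz bound
    centred at each point is a global one, by considering the supremum of the
    points up to which the bound holds. It is used with [dl s t = p (f t - f s)].
    The local hypothesis compares with the centre only, so that mere
    differentiability at each point provides it. *)
Lemma pseudometric_mean_value (R : realType) (dl : R -> R -> R) (a b C : R) :
  a <= b ->
  (forall s u t, dl s t <= dl s u + dl u t) -> (forall s t, dl s t = dl t s) ->
  (forall t, a <= t <= b -> exists2 r, 0 < r &
    forall s, a <= s <= b -> `|s - t| < r -> dl t s <= C * `|s - t|) ->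
  dl a b <= C * (b - a).
Proof.
move=> ab tri sym loc.
pose S := [set s | a <= s <= b /\ dl a s <= C * (s - a)].
have Sa : S a.
  split; first by rewrite lexx ab.
  have [|r r0 /(_ a)] := loc a; first by rewrite lexx ab.
  by rewrite lexx ab subrr normr0 => /(_ isT r0).
have ubS : ubound S b by move=> s [/andP[]].
have hS : has_sup S by split; [exists a|exists b].
set c := sup S.
have ac : a <= c by apply: ub_le_sup => //; exists b.
have cb : c <= b by apply: ge_sup => //; exists a.
have [|r r0 locc] := loc c; first by rewrite ac cb.
have dac : dl a c <= C * (c - a).
  have [s Ss cs] : exists2 s, S s & c - r < s.
    by apply: sup_adherent => //.
  have sc : s <= c by apply: ub_le_sup => //; exists b.
  have [sab das] := Ss.
  have h : dl c s <= C * `|s - c|.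
    by apply: locc => //; rewrite ler0_norm ?subr_le0//; lra.
  rewrite ler0_norm ?subr_le0// in h.
  rewrite (le_trans (tri _ s _))// (sym s c).
  rewrite (le_trans (lerD das h))// -mulrDr.
  by have -> : s - a + - (s - c) = c - a by ring.
have [<-//|cnb] := eqVneq c b.
have cltb : c < b by rewrite lt_neqAle cnb.
pose t := Num.min b (c + r / 2).
have ct : c < t by rewrite lt_min cltb ltrDl divr_gt0.
have tb : t <= b by rewrite ge_min lexx.
have tr : t <= c + r / 2 by rewrite ge_min lexx orbT.
have h : dl c t <= C * `|t - c|.
  apply: locc; first by rewrite tb (le_trans ac)// ltW.
  by rewrite gtr0_norm ?subr_gt0//; lra.
rewrite gtr0_norm ?subr_gt0// in h.
have : S t.
  split; first by rewrite tb (le_trans ac)// ltW.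
  rewrite (le_trans (tri _ c _))//.
  rewrite (le_trans (lerD dac h))// -mulrDr.
  by have -> : c - a + (t - c) = t - a by ring.
move=> /(ub_le_sup (ex_intro _ b ubS)); rewrite -/c leNgt.
by rewrite ct.
Qed.

(** * Convergence, Hausdorff spaces and local completeness *)

Section CSnConvergence.
Context {R : realType} {E : tvsType R[i]}.
Implicit Type p : cseminorm E.

Lemma csn_cvgP (F : set_system E) (FF : Filter F) (l : E) :
  F --> l <-> forall p e, 0 < e -> \forall x \near F, p (x - l) < e.
Proof.
split=> [Fl p e e0|H U nU]; first exact/Fl/csn_nbhs_at.
have := nbhsB (- l) nU; rewrite addNr => /csn_base[p pU].
apply: filterS (H p 1 ltr01) => x /pU[y Uy].
by rewrite addrC => /addIr <-.
Qed.

Lemma csn_hausdorff : hausdorff_space E -> forall x : E,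
  (forall p, p x = 0) -> x = 0.
Proof.
move=> hE x px; apply: hE => A B nA /csn_base[p pB].
exists x; split; first exact: nbhs_singleton.
by apply: pB; rewrite /= px ltr01.
Qed.

(** By homogeneity, an inclusion of unit balls is an inequality of seminorms. *)
Lemma csn_dominated (F : tvsType R[i]) (k : {linear E -> F}) p (q : cseminorm F) :
  (forall x, q (k x) < 1 -> p x < 1) -> forall x, p x <= q (k x).
Proof.
move=> qp x; apply/ler_addgt0Pr => e e0.
have t0 : 0 < q (k x) + e by rewrite ltr_wpDl// csn_ge0.
have := qp (((q (k x) + e)^-1)%:C *: x).
rewrite linearZ/= !csnZ cnorm_real gtr0_norm ?invr_gt0//.
rewrite ![_^-1 * _]mulrC !ltr_pdivrMr// !mul1r ltrDl => /(_ e0)/ltW.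
exact.
Qed.

(** A sequence whose increments decrease geometrically for every seminorm converges
    in a locally complete space. The increments, rescaled, lie in the set [D] of
    the points whose seminorms are bounded by those of all rescaled increments.
    This [D] is the bipolar of the rescaled increments written with seminorms
    instead of functionals, so closedness, absolute convexity and boundedness are
    immediate, and the sequence is Cauchy for the norm of its Banach space. *)
Lemma mackey_cvg (x : nat -> E) : locally_complete E ->
  (forall p, exists C : R, forall m n, (m <= n)%N ->
    2 ^+ m * p (x n - x m) <= C) ->
  exists l : E, x n @[n --> \oo] --> l.
Proof.
move=> lcE hx.
pose D := [set v : E | forall p C, (forall m n, (m <= n)%N ->
    2 ^+ m * p (x n - x m) <= C) -> p v <= C].
have C_ge0 p C : (forall m n, (m <= n)%N -> 2 ^+ m * p (x n - x m) <= C) ->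
    0 <= C.
  by move=> /(_ 0%N 0%N isT); rewrite subrr csn0 mulr0.
have cD : closed D.
  rewrite closure_id; apply/seteqP; split; first exact: subset_closure.
  move=> v clv p C hC; apply/ler_addgt0Pr => e e0.
  have [w [Dw /= pwv]] := clv _ (csn_nbhs_at p v e0).
  rewrite -(subrK w v) (le_trans (csnD _ _ _))// addrC lerD//; first exact: Dw.
  by rewrite csn_distC ltW.
have aD : absolutely_convex D.
  split; first by exists 0 => p C /C_ge0; rewrite csn0.
  move=> v w a b Dv Dw; rewrite !normr_cnorm -rmorphD lecR => ab p C hC.
  have C0 := C_ge0 _ _ hC.
  rewrite (le_trans (csnD _ _ _))// !csnZ.
  apply: (@le_trans _ _ (cnorm a * C + cnorm b * C)).
    by rewrite lerD// ler_wpM2l ?cnorm_ge0//; [exact: Dv|exact: Dw].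
  by rewrite -mulrDl -[leRHS]mul1r ler_wpM2r.
have bD p : exists2 C, 0 < C & forall v, D v -> p v < C.
  have [C hC] := hx p; exists (C + 1) => [|v Dv].
    by rewrite ltr_wpDl// (C_ge0 _ _ hC).
  by rewrite (le_lt_trans (Dv _ _ hC))// ltrDl.
have dD : disk D.
  split => // U /csn_base[p pU]; have [C C0 hC] := bD p.
  exists C => // v Dv; exists (C^-1%:C *: v).
    apply: pU => /=; rewrite csnZ cnorm_real gtr0_norm ?invr_gt0//.
    by rewrite mulrC ltr_pdivrMr// mul1r hC.
  by rewrite scalerA -rmorphM divff ?scale1r// gt_eqF.
have Dx N m n : (N <= m)%N -> (N <= n)%N -> D ((2 ^+ N)%:C *: (x m - x n)).
  wlog mn : m n / (m <= n)%N => [H Nm Nn|Nm Nn p C hC].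
    have [mn|nm] := leqP m n; first exact: H.
    rewrite -opprB -scaleN1r scalerA mulrC -scalerA.
    rewrite -[X in D X]addr0 -(scale0r 0); case: aD => _; apply.
    - by apply: H => //; exact: ltnW.
    - by move=> p C /C_ge0; rewrite csn0.
    - by rewrite normr0 normrN normr1 addr0.
  rewrite csnZ cnorm_real ger0_norm ?exprn_ge0// csn_distC.
  rewrite (le_trans _ (hC m n mn))// ler_wpM2r ?csn_ge0//.
  by rewrite ler_weXn2l// ler1n.
pose u n := x n - x 0.
have Du n : D (u n) by have := Dx 0%N n 0%N isT isT; rewrite expr0 scale1r.
have uuE m n : u m - u n = x m - x n by rewrite /u opprB addrA subrK.
have [|e e0|l [k _ [y Dy lE]] ul] := lcE D cD dD u.
- by move=> n; exists 1%N => //; exists (u n) => //; rewrite scale1r.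
- have [N] : exists N, e^-1 < 2 ^+ N.
    exists (Num.bound e^-1).
    apply: lt_trans (archi_boundP _) _; first by rewrite invr_ge0 ltW.
    by rewrite -natrX ltr_nat ltn_expl.
  have N0 : 0 < 2 ^+ N :> R by rewrite exprn_gt0.
  move=> eN; exists N => m n Nm Nn; rewrite uuE.
  rewrite (_ : x m - x n = ((2 ^+ N)^-1)%:C *: ((2 ^+ N)%:C *: (x m - x n))).
    rewrite (le_lt_trans (gauge_le _ (Dx _ _ _ Nm Nn)))// ?invr_gt0//.
    by rewrite invf_plt.
  by rewrite scalerA -rmorphM mulVf ?scale1r// gt_eqF.
exists (l + x 0); apply/csn_cvgP => p e e0.
have [C C0 hC] := bD p.
have eC : 0 < e / C by rewrite divr_gt0.
have := ul; move=> /cvgrPdist_lt/(_ _ eC); apply: filterS => n.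
rewrite sub0r normrN => uln.
rewrite /= (_ : x n - (l + x 0) = u n - l); last first.
  by rewrite /u opprD addrA addrAC.
have [|y' Dy' ->] := gauge_lt aD (le_lt_trans (ler_norm _) uln).
  exists (1 + k%:R); first by rewrite ltr_wpDr.
  exists ((1 + k%:R)^-1%:C *: u n + (- (k%:R * (1 + k%:R)^-1))%:C *: y).
    case: aD => _; apply => //; rewrite !normr_cnorm !cnorm_real -rmorphD lecR.
    rewrite normrN normrM !ger0_norm ?invr_ge0 ?addr_ge0//.
    by rewrite -[X in X + _]mul1r -mulrDl divff// gt_eqF// ltr_wpDr.
  have h : 1 + k%:R != 0 :> R by rewrite gt_eqF// ltr_wpDr.
  rewrite scalerDr !scalerA -!rmorphM divff// scale1r.
  by rewrite mulrN mulrCA divff// mulr1 rmorphN scaleNr rmorph_nat lE.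
rewrite csnZ cnorm_real gtr0_norm//.
by rewrite -[ltRHS](divfK (_ : C != 0)) ?gt_eqF// ltr_pM2l// hC.
Qed.

End CSnConvergence.

(** * Compactness of annuli and roots of unity near 1 *)

Section Compactness.
Context {R : realType}.

Lemma cnorm_sqr (z : R[i]) : cnorm z ^+ 2 = complex.Re z ^+ 2 + complex.Im z ^+ 2.
Proof. by case: z => a b; rewrite /cnorm /= sqr_sqrtr// addr_ge0 ?sqr_ge0. Qed.

Lemma Re_le_cnorm (z : R[i]) : `|complex.Re z| <= cnorm z.
Proof.
rewrite -(@ler_pXn2r _ 2)// ?nnegrE ?cnorm_ge0// cnorm_sqr real_normK ?num_real//.
by rewrite lerDl sqr_ge0.
Qed.

Lemma Im_le_cnorm (z : R[i]) : `|complex.Im z| <= cnorm z.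
Proof.
rewrite -(@ler_pXn2r _ 2)// ?nnegrE ?cnorm_ge0// cnorm_sqr real_normK ?num_real//.
by rewrite lerDr sqr_ge0.
Qed.

Lemma cnorm_continuous : continuous (@cnorm R).
Proof.
move=> z U /nbhs_ballP[e e0 eU]; apply/nbhs_cnorm; exists e => // w wz.
apply: eU; rewrite -ball_normE /ball_ /=; apply: le_lt_trans wz.
rewrite ler_norml lerBlDr cnorm_distC.
have := cnormD (z - w) w; have := cnormD (w - z) z.
by rewrite !subrK (cnorm_distC w z) => ? ?; apply/andP; split; lra.
Qed.

Lemma complex_mk_continuous : continuous (fun u : R * R => u.1 +i* u.2 : R[i]).
Proof.
move=> [a b] U /nbhs_cnorm[r r0 rU].
have r20 : 0 < r / 2 by rewrite divr_gt0.
exists (ball a (r / 2), ball b (r / 2)) => /=.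
  by split; exact: nbhsx_ballx.
move=> [x y] /= [xa yb]; apply: rU.
have {}xa : `|a - x| < r / 2 by move: xa; rewrite -ball_normE.
have {}yb : `|b - y| < r / 2 by move: yb; rewrite -ball_normE.
rewrite (_ : _ - _ = (x - a)%:C + 'i * (y - b)%:C); last by simpc.
rewrite (le_lt_trans (cnormD _ _))// cnormM !cnorm_real.
rewrite (_ : cnorm 'i = 1) ?mul1r; last by rewrite /cnorm /= expr0n expr1n add0r sqrtr1.
by rewrite [`|x - a|]distrC [`|y - b|]distrC; lra.
Qed.

Lemma compact_annulus (a b : R) : compact [set w : R[i] | a <= cnorm w <= b].
Proof.
pose Q := (fun u : R * R => u.1 +i* u.2 : R[i]) @` (`[- b, b] `*` `[- b, b]).
apply: (@subclosed_compact _ _ Q).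
- have -> : [set w : R[i] | a <= cnorm w <= b] = cnorm @^-1` `[a, b].
    by apply/seteqP; split => w; rewrite /= in_itv.
  by apply: closed_comp; [move=> *; exact: cnorm_continuous|exact: itv_closed].
- apply: continuous_compact.
    by apply: continuous_subspaceT; exact: complex_mk_continuous.
  by apply: compact_setX; exact: segment_compact.
- move=> [x y] /= /andP[_ wb]; exists (x, y) => //=.
  by split; rewrite /= in_itv /= -ler_norml (le_trans _ wb)//;
    [exact: (Re_le_cnorm (x +i* y))|exact: (Im_le_cnorm (x +i* y))].
Qed.

(** Radii of validity depending on the point can be replaced by a single one on a
    compact set. *)
Lemma compact_uniform (K : set R[i]) (P : R -> R[i] -> Prop) : compact K ->
  (forall w0, K w0 -> exists2 r, 0 < r & forall dlt w, 0 < dlt -> dlt < r ->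
    cnorm (w - w0) < r -> P dlt w) ->
  exists2 dlt, 0 < dlt & forall w, K w -> P dlt w.
Proof.
move=> /compact_near_coveringP cK H.
have : \forall dlt \near 0^'+, K `<=` P dlt.
  apply: (cK R (0 : R)^'+ P) => w0 /H[r r0 rP].
  exists ([set w | cnorm (w - w0) < r], [set d | 0 < d /\ d < r]) => /=.
    split; first by apply/nbhs_cnorm; exists r.
    near=> x; split; near: x; [exact: nbhs_right_gt|exact: nbhs_right_lt].
  by move=> [w d] /= [wr [d0 dr]]; exact: rP.
move=> hK; have : \forall dlt \near (0 : R)^'+, 0 < dlt /\ K `<=` P dlt.
  by apply: filterI => //; exact: nbhs_right_gt.
by move=> /filter_ex[d [d0 Kd]]; exists d.
Unshelve. all: by end_near. Qed.

End Compactness.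

Section RootsOfUnity.
Context {R : realType}.

Lemma cnorm_root_unity (w : R[i]) N : (0 < N)%N -> w ^+ N = 1 -> cnorm w = 1.
Proof.
move=> N0 /(congr1 cnorm); rewrite cnormX cnorm1 => /eqP.
by rewrite pexpr_eq1 ?cnorm_ge0// => /eqP.
Qed.

(** Iterated square roots of -1 with nonnegative real part: from
    [(s - 1) * (s + 1) = s ^+ 2 - 1] and [|s + 1| ^+ 2 >= 2], each extraction
    divides the squared distance to 1 by at least 2. *)
Lemma root_unity_near1 (e : R) : 0 < e -> exists w N,
  [/\ (0 < N)%N, w ^+ N = 1, w != 1 & cnorm (w - 1 : R[i]) < e].
Proof.
move=> e0.
have step n : exists w : R[i],
    [/\ w ^+ (2 ^ n.+1) = 1, w != 1 & 2 ^+ n * cnorm (w - 1) ^+ 2 <= 4].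
  elim: n => [|n [w [wN w1 we]]].
    exists (-1); split; first by rewrite sqrrN expr1n.
      by rewrite eq_sym -subr_eq0 opprK (pnatr_eq0 _ 2).
    rewrite -opprD cnormN (_ : 1 + 1 = (2 : R)%:C); last by rewrite rmorph_nat.
    by rewrite cnorm_real expr0 mul1r ger0_norm//; lra.
  have [s [sw s0]] : exists s : R[i], s ^+ 2 = w /\ 0 <= complex.Re s.
    have [s0|s0] := leP 0 (complex.Re (sqrtC w)).
      by exists (sqrtC w); split => //; exact: sqrtCK.
    exists (- sqrtC w); split; first by rewrite sqrrN sqrtCK.
    by case: (sqrtC w) s0 => a b /=; lra.
  exists s; split.
  - by rewrite [X in _ ^+ X]expnS exprM sw.
  - by apply: contra_neq w1 => s1; rewrite -sw s1 expr1n.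
  - have ms : cnorm s = 1.
      have : s ^+ (2 * 2 ^ n.+1) = 1 by rewrite exprM sw.
      by apply: cnorm_root_unity; rewrite muln_gt0 expn_gt0.
    have h : 2 <= cnorm (s + 1) ^+ 2.
      have hs := cnorm_sqr s; rewrite ms in hs; rewrite cnorm_sqr.
      by case: (s) s0 hs => a b /= a0 hs; nra.
    have h2 : cnorm (w - 1) = cnorm (s - 1) * cnorm (s + 1).
      by rewrite -cnormM -subr_sqr expr1n sw.
    rewrite h2 exprMn in we.
    apply: le_trans we; rewrite exprS -mulrA mulrC -mulrA ler_pM2l ?exprn_gt0//.
    by rewrite ler_wpM2l// sqr_ge0.
have [n] : exists n : nat, 4 / e ^+ 2 < 2 ^+ n.
  exists (Num.bound (4 / e ^+ 2)).
  apply: lt_trans (archi_boundP _) _; first by rewrite divr_ge0// sqr_ge0.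
  by rewrite -natrX ltr_nat ltn_expl.
rewrite ltr_pdivrMr ?exprn_gt0// => he.
have [w [wN w1 we]] := step n; exists w, (2 ^ n.+1)%N; split => //.
  by rewrite expn_gt0.
rewrite -(@ltr_pXn2r _ 2)// ?nnegrE ?cnorm_ge0// ?(ltW e0)//.
by rewrite -(@ltr_pM2l _ (2 ^+ n)) ?exprn_gt0// (le_lt_trans we).
Qed.

End RootsOfUnity.

(** * The maximum principle at the centre of a disc *)

Section MaximumPrinciple.
Context {R : realType} {F : tvsType R[i]}.
Implicit Type p : cseminorm F.

(** Strict differentiability, both points being allowed to move. Functions with
    continuous derivative have this property, and its radius is automatically
    locally uniform. *)
Definition strict_diff p (psi : R[i] -> F) (w0 : R[i]) (D : F) :=
  forall e, 0 < e -> exists2 r, 0 < r & forall w w',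
    cnorm (w - w0) < r -> cnorm (w' - w0) < r ->
    p (psi w' - psi w - (w' - w) *: D) <= e * cnorm (w' - w).

(** The sum of [psi] over the vertices of a regular polygon hardly varies with the
    radius. Let [w_k] be the vertices for the radius [t * r] and [v_k] those for
    [s * r]. The ratio [c] of the radial step [v_k - w_k] to the side
    [w_(k+1) - w_k] does not depend on [k]. By complex differentiability at
    [w_k], the value [psi v_k - psi w_k] is [c] times
    [psi w_(k+1) - psi w_k] up to a small error, and the latter differences sum
    to zero around the polygon. The errors are relative to the lengths, so the
    bound is proportional to [|s - t|] and independent of the side length. *)
Lemma radial_increment p (psi : R[i] -> F) (om : R[i]) N (e dlt r s t : R) :
  (0 < N)%N -> om ^+ N = 1 -> om != 1 -> 0 < t -> 0 < r ->
  t * r * cnorm (om - 1) < dlt -> `|s - t| * r < dlt ->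
  (forall w, cnorm w = t * r -> exists D, forall w1 w2, cnorm (w1 - w) < dlt ->
     cnorm (w2 - w) < dlt ->
     p (psi w2 - psi w1 - (w2 - w1) *: D) <= e * cnorm (w2 - w1)) ->
  p (\sum_(k < N) psi ((s * r)%:C * om ^+ k) -
     \sum_(k < N) psi ((t * r)%:C * om ^+ k)) <= N%:R * (2 * e * r) * `|s - t|.
Proof.
move=> N0 omN om1 t0 r0 omd std H.
have mo : cnorm om = 1 by exact: cnorm_root_unity omN.
have mok k : cnorm (om ^+ k) = 1 by rewrite cnormX mo expr1n.
have dlt0 : 0 < dlt by apply: le_lt_trans std; rewrite mulr_ge0// ltW.
have om10 : om - 1 != 0 by rewrite subr_eq0.
have tC0 : t%:C != 0 :> R[i] by exact: realC_neq0.
pose c : R[i] := (s - t)%:C / (t%:C * (om - 1)).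
pose w k := (t * r)%:C * om ^+ k.
pose v k := (s * r)%:C * om ^+ k.
(* The polygon is closed. *)
have tele : \sum_(k < N) (psi (w k.+1) - psi (w k)) = 0.
  rewrite -(big_mkord xpredT (fun k => psi (w k.+1) - psi (w k))).
  rewrite (telescope_sumr (fun k => psi (w k)))//.
  by rewrite /w omN expr0 subrr.
have -> : \sum_(k < N) psi (v k) - \sum_(k < N) psi (w k) =
    \sum_(k < N) (psi (v k) - psi (w k) - c *: (psi (w k.+1) - psi (w k))).
  by rewrite !sumrB -scaler_sumr -sumrB tele scaler0 subr0.
rewrite (le_trans (csn_sum _ _ _ _))//.
rewrite [leRHS](_ : _ = \sum_(k < N) (2 * e * r * `|s - t|)); last first.
  by rewrite sumr_const card_ord -mulr_natl; ring.
apply: ler_sum => k _.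
have mwk : cnorm (w k) = t * r.
  by rewrite cnormM mok mulr1 cnorm_real gtr0_norm// mulr_gt0.
have [D HD] := H (w k) mwk.
have vwE : v k - w k = ((s - t) * r)%:C * om ^+ k.
  by rewrite /v /w -mulrBl -rmorphB -mulrBl.
have mvw : cnorm (v k - w k) = `|s - t| * r.
  by rewrite vwE cnormM mok mulr1 cnorm_real normrM (gtr0_norm r0).
have wwE : w k.+1 - w k = (t * r)%:C * om ^+ k * (om - 1).
  by rewrite /w exprSr mulrA mulrBr mulr1.
have mww : cnorm (w k.+1 - w k) = t * r * cnorm (om - 1).
  by rewrite wwE cnormM; congr (_ * _).
have ww0 : cnorm (w k - w k) < dlt by rewrite subrr cnorm0.
have h1 : p (psi (v k) - psi (w k) - (v k - w k) *: D) <= e * (`|s - t| * r).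
  by rewrite -mvw; apply: HD => //; rewrite mvw.
have h2 : p (psi (w k.+1) - psi (w k) - (w k.+1 - w k) *: D) <=
    e * (t * r * cnorm (om - 1)).
  by rewrite -mww; apply: HD => //; rewrite mww.
have cE : c * (w k.+1 - w k) = v k - w k.
  rewrite wwE vwE /c !rmorphM; field.
  by rewrite om10 tC0.
have mc : cnorm c * (t * r * cnorm (om - 1)) = `|s - t| * r.
  by rewrite -mww -mvw -cE cnormM.
set A := psi (v k) - psi (w k) in h1 *; set B := psi (w k.+1) - psi (w k) in h2 *.
clearbody A B.
have -> : A - c *: B = (A - (v k - w k) *: D) - c *: (B - (w k.+1 - w k) *: D).
  by rewrite scalerBr scalerA cE opprB addrA subrK.
rewrite (le_trans (csnB _ _ _))// csnZ.
have := ler_wpM2l (cnorm_ge0 c) h2; rewrite mulrCA mc => h3.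
by rewrite (le_trans (lerD h1 h3))//; nra.
Qed.

(** The mean of [psi] over the vertices of a polygon inscribed in a circle is almost
    the same for the radii [r] and [tau * r]; for the former it is bounded by [M],
    for the latter it is close to [psi 0]. Nothing but continuity is asked at the
    centre, so that difference quotients are allowed. *)
Lemma max_at_centre p (psi : R[i] -> F) (r M : R) : 0 < r ->
  (forall e, 0 < e -> exists2 t, 0 < t & forall w, cnorm w < t ->
     p (psi w - psi 0) <= e) ->
  (forall w, 0 < cnorm w <= r -> exists D, strict_diff p psi w D) ->
  (forall w, cnorm w = r -> p (psi w) <= M) ->
  p (psi 0) <= M.
Proof.
move=> r0 c0 sd hM.
suff H e : 0 < e -> p (psi 0) <= M + e * (1 + 2 * r).
  apply/ler_addgt0Pr => e e0.
  have r1 : 0 < 1 + 2 * r by lra.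
  have := H (e / (1 + 2 * r)) (divr_gt0 e0 r1).
  by rewrite divfK// gt_eqF.
move=> e0; have [t0 t00 ht0] := c0 _ e0.
(* A radius for which psi is within e of its value at the centre. *)
pose tau := Num.min (1 / 2) (t0 / (2 * r)).
have tau0 : 0 < tau by rewrite lt_min !divr_gt0// mulr_gt0.
have tau1 : tau <= 1 by rewrite ge_min; apply/orP; left; lra.
have taur : tau * r < t0.
  have : tau <= t0 / (2 * r) by rewrite ge_min lexx orbT.
  rewrite ler_pdivlMr ?mulr_gt0//; nra.
have [|dlt dlt0 hd] := @compact_uniform R [set w | tau * r <= cnorm w <= r]
  (fun dlt w => exists D, forall w1 w2, cnorm (w1 - w) < dlt -> cnorm (w2 - w) < dlt ->
     p (psi w2 - psi w1 - (w2 - w1) *: D) <= e * cnorm (w2 - w1))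
  (@compact_annulus R (tau * r) r).
  move=> w0 /= /andP[w0t w0r].
  have [|D HD] := sd w0; first by rewrite w0r andbT (lt_le_trans _ w0t)// mulr_gt0.
  have [d d0 hd] := HD _ e0; exists (d / 2); first by rewrite divr_gt0.
  move=> dl w dl0 dld wd; exists D => w1 w2 w1d w2d; apply: hd.
    by rewrite (le_lt_trans (cnorm_triangle _ _ w))//; lra.
  by rewrite (le_lt_trans (cnorm_triangle _ _ w))//; lra.
have [om [N [N0 omN om1 omd]]] := root_unity_near1 (divr_gt0 dlt0 r0).
have mo : cnorm om = 1 by exact: cnorm_root_unity omN.
have mok k : cnorm (om ^+ k) = 1 by rewrite cnormX mo expr1n.
(* T t is N times the mean over the polygon of radius t * r. *)
pose T t := \sum_(k < N) psi ((t * r)%:C * om ^+ k).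
have NR0 : 0 < N%:R :> R by rewrite ltr0n.
have hT : p (T 1 - T tau) <= N%:R * (2 * e * r) * (1 - tau).
  rewrite csn_distC.
  apply: (@pseudometric_mean_value _ (fun s t => p (T s - T t)) tau 1) => //.
  - by move=> s u t; exact: csn_triangle.
  - by move=> s t; exact: csn_distC.
  move=> t /andP[taut t1]; exists (dlt / r); first by rewrite divr_gt0.
  move=> s _ std; have t_0 : 0 < t by rewrite (lt_le_trans tau0).
  rewrite csn_distC; apply: (@radial_increment _ _ om N e dlt) => //.
  - rewrite ltr_pdivlMr// in omd.
    rewrite (le_lt_trans _ omd)// mulrAC mulrC [leRHS]mulrC ler_pM2l//.
    by rewrite ler_piMl ?cnorm_ge0.
  - by rewrite -ltr_pdivlMr.
  - move=> w wt; apply: hd; rewrite /= wt ler_pM2r// taut/=.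
    by rewrite -[leRHS]mul1r ler_pM2r.
have h1 : p (T 1) <= N%:R * M.
  rewrite (le_trans (csn_sum _ _ _ _))//.
  rewrite [leRHS](_ : _ = \sum_(k < N) M); last first.
    by rewrite sumr_const card_ord mulr_natl.
  apply: ler_sum => k _; apply: hM.
  by rewrite cnormM mok mulr1 cnorm_real mul1r gtr0_norm.
have h2 : p (T tau - N%:R *: psi 0) <= N%:R * e.
  have -> : N%:R *: psi 0 = \sum_(k < N) psi 0.
    by rewrite sumr_const card_ord scaler_nat.
  rewrite -sumrB (le_trans (csn_sum _ _ _ _))//.
  rewrite [leRHS](_ : _ = \sum_(k < N) e); last first.
    by rewrite sumr_const card_ord mulr_natl.
  apply: ler_sum => k _; apply: ht0.
  by rewrite cnormM mok mulr1 cnorm_real gtr0_norm// mulr_gt0.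
have h3 : N%:R * p (psi 0) <= N%:R * (M + e * (1 + 2 * r)).
  have -> : N%:R * p (psi 0) = p (N%:R *: psi 0).
    by rewrite csnZ -(rmorph_nat (real_complex R)) cnorm_real ger0_norm.
  have -> : N%:R *: psi 0 = T 1 - (T 1 - T tau) - (T tau - N%:R *: psi 0).
    by rewrite subKr subKr.
  rewrite (le_trans (csnB _ _ _))// (le_trans (lerD (csnB _ _ _) (lexx _)))//.
  rewrite (le_trans (lerD (lerD h1 hT) h2))//.
  have hh : 0 <= N%:R * (2 * e * r) * tau by rewrite !mulr_ge0// ltW.
  lra.
by rewrite ler_pM2l in h3.
Qed.

End MaximumPrinciple.

(** * Cauchy's estimate *)

Lemma subr_subrACA (V : zmodType) (a b c d : V) :
  a - b - (c - d) = (a - c) - (b - d).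
Proof. by rewrite opprD addrACA -opprD. Qed.

(** With [a], [b], [i] the inverses of [w'], [w], [w0], and [k = w' - w], this
    expresses the error in the quotient rule for [w^-1 *: phi w] through the error
    [X] in the differentiability of [phi]. *)
Lemma difference_quotient_identity (K : fieldType) (V : lmodType K) (a b i k : K)
    (X D Y C : V) : a - b = - (k * (b * a)) ->
  a *: (X + k *: D + Y + C) - b *: (Y + C) - k *: (i *: D - i *: (i *: C)) =
  a *: X + k *: ((a - i) *: D - (b * a) *: Y
    - (b * (a - i) + i * (b - i)) *: C).
Proof.
move=> ab.
rewrite [a *: (_ + _ + _ + _)]scalerDr 2!(scalerDr a) (scalerDr b).
rewrite [k *: (i *: _ - _)]scalerBr !scalerA opprB opprD !addrA.
rewrite [LHS](ACl (1*(2*8)*(3*5)*((4*6)*7)))%AC/=.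
rewrite -!scaleNr -!scalerDl ab !scalerDr !scalerA -!addrA.
by congr (_ + (_ *: _ + (_ *: _ + _ *: _))); ring.
Qed.

Section StrictDiff.
Context {R : realType} {F : tvsType R[i]}.
Implicit Types (p : cseminorm F) (phi : R[i] -> F).

Lemma strict_diffB p phi psi w0 D D' : strict_diff p phi w0 D ->
  strict_diff p psi w0 D' ->
  strict_diff p (fun w => phi w - psi w) w0 (D - D').
Proof.
move=> h1 h2 e e0; have e20 : 0 < e / 2 by rewrite divr_gt0.
have [r1 r10 H1] := h1 _ e20; have [r2 r20 H2] := h2 _ e20.
exists (Num.min r1 r2) => [|w w']; first by rewrite lt_min r10.
rewrite !lt_min => /andP[wr1 wr2] /andP[w'r1 w'r2].
have -> : phi w' - psi w' - (phi w - psi w) - (w' - w) *: (D - D') =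
  (phi w' - phi w - (w' - w) *: D) - (psi w' - psi w - (w' - w) *: D').
  by rewrite scalerBr (subr_subrACA (phi w') (psi w')); exact: subr_subrACA.
rewrite (le_trans (csnB _ _ _))//.
by rewrite (le_trans (lerD (H1 _ _ wr1 w'r1) (H2 _ _ wr2 w'r2)))//; lra.
Qed.

Lemma strict_diffZ p phi w0 D (c : R[i]) : strict_diff p phi w0 D ->
  strict_diff p (fun w => c *: phi w) w0 (c *: D).
Proof.
move=> h1 e e0; have c1 : 0 < cnorm c + 1 by rewrite ltr_wpDl ?cnorm_ge0.
have [r1 r10 H1] := h1 _ (divr_gt0 e0 c1).
exists r1 => // w w' wr w'r.
have -> : c *: phi w' - c *: phi w - (w' - w) *: (c *: D) =
    c *: (phi w' - phi w - (w' - w) *: D).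
  by rewrite !scalerBr !scalerA [c * _]mulrC.
rewrite csnZ (le_trans (ler_wpM2l (cnorm_ge0 c) (H1 _ _ wr w'r)))//.
rewrite mulrA ler_wpM2r ?cnorm_ge0// mulrCA ger_pMr//.
by rewrite ler_pdivrMr// mul1r lerDl.
Qed.

Lemma strict_diff_quotient p phi w0 D (c : F) : w0 != 0 ->
  strict_diff p phi w0 D ->
  exists D', strict_diff p (fun w => w^-1 *: (phi w - c)) w0 D'.
Proof.
move=> w00 H; exists (w0^-1 *: D - w0^-1 *: (w0^-1 *: (phi w0 - c))) => e e0.
have m0 : 0 < cnorm w0 by rewrite cnorm_gt0.
set m := cnorm w0 in m0.
pose B := 2 / m; have B0 : 0 < B by rewrite divr_gt0.
pose e1 := e / (2 * B); have e10 : 0 < e1 by rewrite divr_gt0// mulr_gt0.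
have P0 := csn_ge0 p D; have Q0 := csn_ge0 p (phi w0 - c).
set P := p D in P0; set Q := p (phi w0 - c) in Q0.
(* B bounds the inverses of w0 and of the nearby points; the terms of K come
   from the three summands of the error that vanish at w0, the final 1 making it
   positive. *)
pose K := B ^+ 2 * P + B ^+ 2 * (e1 + P) + 2 * B ^+ 3 * Q + 1.
have K0 : 0 < K.
  have B2 : 0 <= B ^+ 2 by rewrite exprn_ge0// ltW.
  have B3 : 0 <= B ^+ 3 by rewrite exprn_ge0// ltW.
  have e1P : 0 <= e1 + P by rewrite addr_ge0// ltW.
  have := mulr_ge0 B2 P0; have := mulr_ge0 B2 e1P; have := mulr_ge0 B3 Q0.
  by rewrite /K; lra.
have [r r0 Hr] := H _ e10.
pose dl := Num.min r (Num.min (m / 2) (e / (2 * K))).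
have dl0 : 0 < dl by rewrite !lt_min r0 !divr_gt0// mulr_gt0.
have dlr : dl <= r by rewrite ge_min lexx.
have dlm : dl <= m / 2 by rewrite !ge_min lexx orbT.
have dlK : dl <= e / (2 * K) by rewrite !ge_min lexx !orbT.
exists dl => // w w' wd w'd.
have inv_le v : cnorm (v - w0) < dl -> v != 0 /\ cnorm v^-1 <= B.
  move=> vd; have hv : m / 2 <= cnorm v.
    have := cnormD v (w0 - v); rewrite addrC subrK (cnorm_distC w0 v) -/m; lra.
  have v0 : 0 < cnorm v by apply: lt_le_trans hv; rewrite divr_gt0.
  split; first by rewrite -cnorm_gt0.
  by rewrite cnormV invf_ple ?posrE// /B invf_div.
have [w_0 wB] := inv_le _ wd; have [w'_0 w'B] := inv_le _ w'd.
have w0B : cnorm w0^-1 <= B by have [|//] := inv_le w0; rewrite subrr cnorm0.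
have inv_dist v : cnorm (v - w0) < dl -> cnorm (v^-1 - w0^-1) <= B ^+ 2 * dl.
  move=> vd; have [v0 vB] := inv_le _ vd.
  have -> : v^-1 - w0^-1 = v^-1 * w0^-1 * (w0 - v) by field; rewrite v0 w00.
  rewrite !cnormM cnorm_distC expr2; apply: ler_pM; rewrite ?mulr_ge0 ?cnorm_ge0//.
    by apply: ler_pM; rewrite ?cnorm_ge0.
  exact: ltW.
have h1 := Hr w w' (lt_le_trans wd dlr) (lt_le_trans w'd dlr).
have h2 : p (phi w - phi w0) <= (e1 + P) * dl.
  have := Hr w0 w; rewrite subrr cnorm0 => /(_ r0 (lt_le_trans wd dlr)) h.
  rewrite -(subrK ((w - w0) *: D) (phi w - phi w0)) (le_trans (csnD _ _ _))//.
  rewrite csnZ -/P (le_trans (lerD h (lexx _)))// mulrC -mulrDr mulrC.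
  by rewrite ler_wpM2l// ?addr_ge0// ltW.
set X := phi w' - phi w - (w' - w) *: D in h1.
set Y := phi w - phi w0 in h2.
set C := phi w0 - c.
have -> : w'^-1 *: (phi w' - c) - w^-1 *: (phi w - c) -
    (w' - w) *: (w0^-1 *: D - w0^-1 *: (w0^-1 *: C)) =
  w'^-1 *: X + (w' - w) *: ((w'^-1 - w0^-1) *: D - (w^-1 * w'^-1) *: Y
    - (w^-1 * (w'^-1 - w0^-1) + w0^-1 * (w^-1 - w0^-1)) *: C).
  (* Write both values through phi w0, D and the errors X and Y. *)
  have -> : phi w' - c = X + (w' - w) *: D + Y + C.
    by rewrite /X /Y /C subrK !subrKA.
  have -> : phi w - c = Y + C by rewrite /Y /C subrKA.
  by apply: difference_quotient_identity; field; rewrite w_0 w'_0.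
rewrite (le_trans (csnD _ _ _))// [p (_^-1 *: X)]csnZ [p ((w' - w) *: _)]csnZ.
have dl0' := ltW dl0.
have B0' := ltW B0.
have e1P : 0 <= e1 + P by rewrite addr_ge0// ltW.
have T1 : cnorm w'^-1 * p X <= B * (e1 * cnorm (w' - w)).
  by apply: ler_pM; rewrite ?cnorm_ge0 ?csn_ge0.
have T2 : p ((w'^-1 - w0^-1) *: D) <= B ^+ 2 * dl * P.
  by rewrite csnZ ler_wpM2r// inv_dist.
have T3 : p ((w^-1 * w'^-1) *: Y) <= B ^+ 2 * ((e1 + P) * dl).
  rewrite csnZ cnormM expr2; apply: ler_pM; rewrite ?mulr_ge0 ?cnorm_ge0 ?csn_ge0//.
  by apply: ler_pM; rewrite ?cnorm_ge0.
have T4 : p ((w^-1 * (w'^-1 - w0^-1) + w0^-1 * (w^-1 - w0^-1)) *: C) <=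
    2 * B ^+ 3 * dl * Q.
  rewrite csnZ ler_wpM2r// (le_trans (cnormD _ _))// !cnormM.
  have -> : 2 * B ^+ 3 * dl = B * (B ^+ 2 * dl) + B * (B ^+ 2 * dl) by ring.
  by apply: lerD; apply: ler_pM; rewrite ?cnorm_ge0 ?inv_dist.
have T5 : dl * K <= e / 2.
  by move: dlK; rewrite invfM mulrA ler_pdivlMr.
have T6 : p ((w'^-1 - w0^-1) *: D - (w^-1 * w'^-1) *: Y
    - (w^-1 * (w'^-1 - w0^-1) + w0^-1 * (w^-1 - w0^-1)) *: C) <= e / 2.
  rewrite (le_trans (csnB _ _ _))// (le_trans (lerD (csnB _ _ _) (lexx _)))//.
  rewrite (le_trans (lerD (lerD T2 T3) T4))// (le_trans _ T5)//.
  by rewrite /K; lra.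
have T7 : B * e1 = e / 2 by rewrite /e1; field; rewrite gt_eqF.
rewrite mulrA T7 in T1.
by rewrite (le_trans (lerD T1 (ler_wpM2l (cnorm_ge0 _) T6)))//; lra.
Qed.

(** The difference quotient of [phi] at 0 extends continuously by [D0], and on the
    circle of radius [r] it is at most [2 * M / r]: apply the maximum principle. *)
Lemma cauchy_estimate p phi (D0 : F) (r M : R) : 0 < r ->
  (forall w, cnorm w <= r -> exists D, strict_diff p phi w D) ->
  strict_diff p phi 0 D0 ->
  (forall w, cnorm w <= r -> p (phi w) <= M) ->
  p D0 <= 2 * M / r.
Proof.
move=> r0 sd sd0 hM.
pose psi (w : R[i]) := if w == 0 then D0 else w^-1 *: (phi w - phi 0).
have -> : D0 = psi 0 by rewrite /psi eqxx.
apply: (@max_at_centre _ _ _ _ r) => //.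
- move=> e e0; have [t t0 Ht] := sd0 e e0; exists t => // w wt.
  rewrite /psi eqxx; case: eqVneq => [_|w0]; first by rewrite subrr csn0 ltW.
  have := Ht 0 w; rewrite !subr0 cnorm0 => /(_ t0 wt) h.
  rewrite -[X in _ - X](scale1r D0) -(mulVf w0) -scalerA -scalerBr csnZ cnormV.
  by rewrite mulrC ler_pdivrMr ?cnorm_gt0.
- move=> w /andP[w0 wr]; have [D HD] := sd w wr.
  rewrite cnorm_gt0 in w0.
  have [D' HD'] := strict_diff_quotient (phi 0) w0 HD; exists D' => e e0.
  have [t t0 Ht] := HD' e e0.
  exists (Num.min t (cnorm w)); first by rewrite lt_min t0 cnorm_gt0.
  have nz v : cnorm (v - w) < cnorm w -> v != 0.
    by apply: contraTneq => ->; rewrite sub0r cnormN ltxx.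
  move=> v v'; rewrite !lt_min => /andP[vt vw] /andP[v't v'w].
  by rewrite /psi (negbTE (nz _ vw)) (negbTE (nz _ v'w)); exact: Ht.
- move=> w wr; have w0 : w != 0 by rewrite -cnorm_gt0 wr.
  rewrite /psi (negbTE w0) csnZ cnormV wr mulrC ler_pM2r ?invr_gt0//.
  rewrite (le_trans (csnB _ _ _))// mulr_natl mulr2n.
  by apply: lerD; apply: hM; rewrite ?wr ?cnorm0 // ltW.
Qed.

End StrictDiff.

(** * Complex C^1 functions of several variables *)

Section SeveralVariables.
Context {R : realType} {d : nat}.
Implicit Types (z w : 'rV[R[i]]_d).

(** Membership of [w] in the open polydisc of centre [z] and radius [r]. *)
Definition row_near (w z : 'rV[R[i]]_d) (r : R) :=
  forall j, cnorm (w 0 j - z 0 j) < r.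

Lemma row_near_refl z r : 0 < r -> row_near z z r.
Proof. by move=> r0 j; rewrite subrr cnorm0. Qed.

Lemma row_near_le w z r s : r <= s -> row_near w z r -> row_near w z s.
Proof. by move=> rs wz j; exact: lt_le_trans (wz j) rs. Qed.

Lemma row_near_trans v w z r s : row_near v w r -> row_near w z s ->
  row_near v z (r + s).
Proof.
by move=> vw wz j; rewrite (le_lt_trans (cnorm_triangle _ _ (w 0 j)))// ltrD.
Qed.

Lemma row_near_line z j h r : cnorm h < r -> row_near (z + h *: delta_mx 0 j) z r.
Proof.
move=> hr k; rewrite !mxE eqxx/= addrAC subrr add0r cnormM.
case: (k == j); rewrite ?cnorm1 ?cnorm0 ?mulr1 ?mulr0//.
by rewrite (le_lt_trans (cnorm_ge0 h)).
Qed.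

Lemma row_near_shift w z v r : row_near w z r -> row_near (w + v) (z + v) r.
Proof. by move=> wz j; rewrite !mxE opprD addrACA subrr addr0. Qed.

Lemma row_near_segment w z j h r (t : R) : 0 <= t <= 1 -> row_near w z r ->
  row_near (w + h *: delta_mx 0 j) z r ->
  row_near (w + (t%:C * h) *: delta_mx 0 j) z r.
Proof.
move=> /andP[t0 t1] wz whz k; have := wz k; have := whz k.
rewrite !mxE eqxx/=; set b := (k == j)%:R; set a := w 0 k; set c := z 0 k.
move=> h1 h2.
have -> : a + t%:C * h * b - c = t%:C * (a + h * b - c) + (1 - t)%:C * (a - c).
  by rewrite rmorphB rmorph1; ring.
rewrite (le_lt_trans (cnormD _ _))// !cnormM !cnorm_real.
rewrite !ger0_norm//; last by rewrite subr_ge0.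
have := cnorm_ge0 (a + h * b - c); have := cnorm_ge0 (a - c).
set x := cnorm _ in h2 *; set y := cnorm _ in h1 *.
move=> x0 y0.
have [t_1|t_1] := eqVneq t 1; first by rewrite t_1 mul1r subrr mul0r addr0.
have : t * y <= t * r by rewrite ler_wpM2l// ltW.
have : (1 - t) * x < (1 - t) * r.
  by rewrite ltr_pM2l// subr_gt0 lt_neqAle t_1.
lra.
Qed.

Lemma open_row (Omega : set 'rV[R[i]]_d) z : open Omega -> Omega z ->
  exists2 r, 0 < r & forall w, row_near w z r -> Omega w.
Proof. by move=> oO Oz; apply/nbhs_row; exact: open_nbhs_nbhs. Qed.

Context {F : tvsType R[i]}.
Implicit Types (g G : 'rV[R[i]]_d -> F) (p : cseminorm F) (Omega : set 'rV[R[i]]_d).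

Lemma csn_dlimP (u : R[i] -> F) (l : F) :
  u h @[h --> 0^'] --> l <-> forall p e, 0 < e -> exists2 r, 0 < r &
    forall h, h != 0 -> cnorm h < r -> p (u h - l) < e.
Proof.
split=> [/csn_cvgP H p e e0|H]; first by have /dnbhs_cnorm := H p e e0.
by apply/csn_cvgP => p e e0; apply/dnbhs_cnorm; exact: H.
Qed.

Lemma row_contP G z : {for z, continuous G} <->
  forall p e, 0 < e -> exists2 r, 0 < r &
    forall w, row_near w z r -> p (G w - G z) < e.
Proof.
split=> [/(csn_cvgP (fmap_filter G (nbhs_filter z))) H p e e0|H].
  by have /nbhs_row := H p e e0.
apply: (iffRL (csn_cvgP (fmap_filter G (nbhs_filter z)) _)) => p e e0.
by apply/nbhs_row; exact: H.
Qed.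

Lemma csn_dlim_unique (u : R[i] -> F) (l l' : F) : hausdorff_space F ->
  u h @[h --> 0^'] --> l -> u h @[h --> 0^'] --> l' -> l = l'.
Proof.
move=> hF /csn_dlimP H /csn_dlimP H'.
apply/eqP; rewrite -subr_eq0; apply/eqP; apply: csn_hausdorff => // p.
apply/eqP; rewrite eq_le csn_ge0 andbT; apply/ler_addgt0Pr => e e0.
have e20 : 0 < e / 2 by rewrite divr_gt0.
have [r r0 Hr] := H p _ e20; have [r' r'0 Hr'] := H' p _ e20.
pose h : R[i] := (Num.min r r' / 2)%:C.
have m0 : 0 < Num.min r r' by rewrite lt_min r0.
have h0 : h != 0 by rewrite realC_neq0// divr_gt0.
have hm : cnorm h < Num.min r r'.
  by rewrite cnorm_real gtr0_norm ?divr_gt0//; set m := Num.min _ _ in m0 *; lra.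
move: hm; rewrite lt_min => /andP[hr hr'].
rewrite add0r (le_trans (csn_triangle _ (u h) _ _))// csn_distC.
by rewrite ltW//; have := ltrD (Hr h h0 hr) (Hr' h h0 hr'); rewrite -splitr.
Qed.

Lemma cpartialP Omega g z j : cdiff1 Omega g -> Omega z ->
  cquotient g z j h @[h --> 0^'] --> cpartial j g z.
Proof.
move=> Dg Oz; rewrite /cpartial.
by case: xgetP => [x _ //|]; have [l Hl] := Dg z Oz j => /(_ l).
Qed.

Lemma cpartial_unique g z j l : hausdorff_space F ->
  cquotient g z j h @[h --> 0^'] --> l -> cpartial j g z = l.
Proof.
move=> hF Hl; rewrite /cpartial.
case: xgetP => [x _ Hx|/(_ l)//].
exact: csn_dlim_unique hF Hx Hl.
Qed.

Lemma cquotientE g z j h : h != 0 ->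
  h *: cquotient g z j h = g (z + h *: delta_mx 0 j) - g z.
Proof. by move=> h0; rewrite /cquotient scalerA divff// scale1r. Qed.

(** Mean value inequality along a complex segment, applied to
    [k |-> g (z + k *: e_j) - k *: l]. *)
Lemma line_mean_value p g z j h l C :
  (forall t : R, 0 <= t <= 1 -> exists2 lt : F,
    cquotient g (z + (t%:C * h) *: delta_mx 0 j) j k @[k --> 0^'] --> lt &
    p (lt - l) <= C) ->
  p (g (z + h *: delta_mx 0 j) - g z - h *: l) <= C * cnorm h.
Proof.
move=> H; have [->|h0] := eqVneq h 0.
  by rewrite !scale0r addr0 subrr subr0 csn0 cnorm0 mulr0.
have mh0 : 0 < cnorm h by rewrite cnorm_gt0.
apply/ler_addgt0Pr => e e0.
pose G (t : R) := g (z + (t%:C * h) *: delta_mx 0 j) - (t%:C * h) *: l.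
have -> : g (z + h *: delta_mx 0 j) - g z - h *: l = G 1 - G 0.
  rewrite /G rmorph1 mul1r rmorph0 mul0r !scale0r addr0 subr0.
  by rewrite addrAC.
rewrite csn_distC.
have -> : C * cnorm h + e = (C * cnorm h + e) * (1 - 0) by rewrite subr0 mulr1.
apply: (@pseudometric_mean_value R (fun s t => p (G s - G t))) => //.
- by move=> s u t; exact: csn_triangle.
- by move=> s t; exact: csn_distC.
move=> t t01; have [lt Hlt ltl] := H t t01.
have [r r0 Hr] := (csn_dlimP _ _).1 Hlt p _ (divr_gt0 e0 mh0).
exists (r / cnorm h); first by rewrite divr_gt0.
move=> s _; rewrite ltr_pdivlMr// => str.
have [->|st] := eqVneq s t; first by rewrite !subrr csn0 normr0 mulr0.
pose k : R[i] := (s - t)%:C * h.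
have mk : cnorm k = `|s - t| * cnorm h by rewrite cnormM cnorm_real.
have k0 : k != 0 by rewrite -cnorm_gt0 mk mulr_gt0// normr_gt0 subr_eq0.
have := Hr k k0; rewrite mk => /(_ str)/ltW Hk.
rewrite csn_distC.
have skE : s%:C * h = t%:C * h + k by rewrite /k -mulrDl -rmorphD addrC subrK.
have -> : G s - G t = k *: (cquotient g (z + (t%:C * h) *: delta_mx 0 j) j k - lt)
    + k *: (lt - l).
  rewrite -scalerDr subrKA scalerBr cquotientE// /G skE !scalerDl addrA.
  by rewrite subr_subrACA [_ *: l + _]addrC addrK.
rewrite (le_trans (csnD _ _ _))// !csnZ mk -mulrDr -mulrA [leRHS]mulrC.
rewrite ler_wpM2l// mulrC.
have := ler_wpM2r (ltW mh0) (lerD Hk ltl).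
have -> // : (e / cnorm h + C) * cnorm h = C * cnorm h + e.
by rewrite mulrDl divfK ?gt_eqF// addrC.
Qed.

(** Both sides of the equivalence are compared with this notion, which is the same
    in a space and in its completion up to the existence of the derivatives. *)
Definition complex_C1 Omega g := cdiff1 Omega g /\
  forall j z, Omega z -> {for z, continuous (cpartial j g)}.

Lemma complex_C1_line Omega g z p e j : open Omega -> complex_C1 Omega g -> Omega z ->
  0 < e -> exists2 r, 0 < r & forall w h, row_near w z r ->
    row_near (w + h *: delta_mx 0 j) z r ->
    p (g (w + h *: delta_mx 0 j) - g w - h *: cpartial j g z) <= e * cnorm h.
Proof.
move=> oO [Dg Cg] Oz e0.
have [r1 r10 Or] := open_row oO Oz.
have [r2 r20 Hr] := (row_contP _ _).1 (Cg j z Oz) p e e0.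
exists (Num.min r1 r2); first by rewrite lt_min r10.
move=> w h wz whz; apply: line_mean_value => t t01.
have zt := row_near_segment t01 wz whz.
exists (cpartial j g (w + (t%:C * h) *: delta_mx 0 j)).
  apply: cpartialP Dg _; apply: Or; apply: row_near_le zt.
  by rewrite ge_min lexx.
by apply/ltW/Hr; apply: row_near_le zt; rewrite ge_min lexx orbT.
Qed.

(** Total differentiability is reduced to partial derivatives along this path, which
    stays in every polydisc that contains its ends. *)
Lemma row_coordinate_path (w w' : 'rV[R[i]]_d) : exists a : nat -> 'rV[R[i]]_d,
  [/\ a 0 = w, a d = w',
    forall m k, a m 0 k = w 0 k \/ a m 0 k = w' 0 k &
    forall m : 'I_d, a m.+1 = a m + (w' 0 m - w 0 m) *: delta_mx 0 m].
Proof.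
exists (fun m => \row_k if (k < m)%N then w' 0 k else w 0 k); split.
- by apply/rowP => k; rewrite mxE.
- by apply/rowP => k; rewrite mxE ltn_ord.
- by move=> m k; rewrite mxE; case: ifP; [right|left].
- move=> m; apply/rowP => k; rewrite !mxE eqxx/= ltnS leq_eqVlt.
  have [->|km] := eqVneq k m.
    by rewrite eqxx/= ltnn mulr1 addrC subrK.
  have -> : (nat_of_ord k == nat_of_ord m) = false by exact/negbTE.
  by rewrite /= mulr0 addr0.
Qed.

(** Continuous partial derivatives give strict total differentiability, by following
    the coordinate path and summing the estimates along its edges. *)
Lemma complex_C1_total Omega g z p e : open Omega -> complex_C1 Omega g -> Omega z ->
  0 < e -> exists2 r, 0 < r & forall w w', row_near w z r -> row_near w' z r ->
    p (g w' - g w - \sum_j (w' 0 j - w 0 j) *: cpartial j g z) <=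
    e * \sum_j cnorm (w' 0 j - w 0 j).
Proof.
move=> oO Hg Oz e0.
have [r r0 Hr] : exists2 r, 0 < r & forall j w h, row_near w z r ->
    row_near (w + h *: delta_mx 0 j) z r ->
    p (g (w + h *: delta_mx 0 j) - g w - h *: cpartial j g z) <= e * cnorm h.
  have /choice[rr Hrr] j : exists r, 0 < r /\ forall w h, row_near w z r ->
      row_near (w + h *: delta_mx 0 j) z r ->
      p (g (w + h *: delta_mx 0 j) - g w - h *: cpartial j g z) <= e * cnorm h.
    by have [r r0 Hr] := complex_C1_line p j oO Hg Oz e0; exists r.
  exists (\big[Num.min/1]_j rr j) => [|j w h wz whz].
    by apply/bigmin_gtP; split => // j _; have [] := Hrr j.
  have lej : \big[Num.min/1]_j rr j <= rr j by exact: bigmin_le_cond.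
  by apply: (Hrr j).2; exact: row_near_le lej _.
exists r => // w w' wz w'z; have [a [a0 ad ak aS]] := row_coordinate_path w w'.
have az m : row_near (a m) z r by move=> k; have [->|->] := ak m k.
have -> : g w' - g w = \sum_(m < d) (g (a m.+1) - g (a m)).
  rewrite -(big_mkord xpredT (fun m => g (a m.+1) - g (a m))).
  by rewrite (telescope_sumr (fun m => g (a m)))// a0 ad.
rewrite -sumrB (le_trans (csn_sum _ _ _ _))// mulr_sumr.
apply: ler_sum => m _; have := az m.+1; rewrite !aS => amS.
exact: Hr.
Qed.

End SeveralVariables.

(** * Partial derivatives of complex C^1 functions *)

Section Regularity.
Context {R : realType} {d : nat} {F : tvsType R[i]}.
Implicit Types (g G : 'rV[R[i]]_d -> F) (p : cseminorm F) (Omega : set 'rV[R[i]]_d).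
Implicit Types (z b c : 'rV[R[i]]_d).

Lemma complex_C1_strict Omega g p c j (x : R[i]) : open Omega -> complex_C1 Omega g ->
  Omega (c + x *: delta_mx 0 j) ->
  strict_diff p (fun w => g (c + w *: delta_mx 0 j)) x
    (cpartial j g (c + x *: delta_mx 0 j)).
Proof.
move=> oO Hg Ox e e0; have [r r0 Hr] := complex_C1_line p j oO Hg Ox e0.
exists r => // w w' wx w'x.
have near_x v : cnorm (v - x) < r ->
    row_near (c + v *: delta_mx 0 j) (c + x *: delta_mx 0 j) r.
  move=> /(row_near_line (c + x *: delta_mx 0 j) j).
  by rewrite -addrA -scalerDl [x + _]addrC subrK.
have E : c + w' *: delta_mx 0 j =
    c + w *: delta_mx 0 j + (w' - w) *: delta_mx 0 j :> 'rV[R[i]]_d.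
  by rewrite -addrA -scalerDl [w + _]addrC subrK.
by rewrite E; apply: Hr; [exact: near_x|rewrite -E; exact: near_x].
Qed.

(** Near each point the difference quotients of [g] are close to the derivative
    there; compactness of the closed disc makes this uniform along the disc. *)
Lemma cquotient_uniform_cauchy Omega g p z j k r e : open Omega ->
  complex_C1 Omega g -> 0 < e ->
  (forall x, cnorm x <= r -> Omega (z + x *: delta_mx 0 j)) ->
  exists2 rho, 0 < rho & forall x c h h', cnorm x <= r ->
    row_near c (z + x *: delta_mx 0 j) rho -> h != 0 -> h' != 0 ->
    cnorm h < rho -> cnorm h' < rho ->
    [/\ Omega c, Omega (c + h *: delta_mx 0 k) &
        p (cquotient g c k h - cquotient g c k h') <= e].
Proof.
move=> oO Hg e0 dO.
pose P (dl : R) (x : R[i]) := forall c h h',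
    row_near c (z + x *: delta_mx 0 j) dl -> h != 0 -> h' != 0 ->
    cnorm h < dl -> cnorm h' < dl ->
    [/\ Omega c, Omega (c + h *: delta_mx 0 k) &
        p (cquotient g c k h - cquotient g c k h') <= e].
have [|rho rho0 H] := @compact_uniform R _ P (@compact_annulus R 0 r).
  move=> x0 /= /andP[_ x0r]; have Oz := dO _ x0r.
  have e20 : 0 < e / 2 by rewrite divr_gt0.
  have [s s0 Hs] := complex_C1_line p k oO Hg Oz e20.
  have [t t0 Ht] := open_row oO Oz.
  pose q := Num.min s t / 3.
  have m0 : 0 < Num.min s t by rewrite lt_min s0.
  have q0 : 0 < q by rewrite divr_gt0.
  have qs : q + q + q <= s.
    have : Num.min s t <= s by rewrite ge_min lexx.
    by rewrite /q; lra.
  have qt : q + q + q <= t.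
    have : Num.min s t <= t by rewrite ge_min lexx orbT.
    by rewrite /q; lra.
  exists q => // dl x dl0 dlq xx0 c h h' cz h0 h'0 hd h'd.
  have cx0 : row_near c (z + x0 *: delta_mx 0 j) (q + q).
    apply: (row_near_trans (row_near_le (ltW dlq) cz)).
    have := row_near_line (z + x0 *: delta_mx 0 j) j xx0.
    by rewrite -addrA -scalerDl [x0 + _]addrC subrK.
  have chx0 v : cnorm v < dl ->
      row_near (c + v *: delta_mx 0 k) (z + x0 *: delta_mx 0 j) (q + q + q).
    move=> vd; rewrite [_ + q]addrC; apply: row_near_trans cx0.
    by apply: row_near_line; exact: lt_trans dlq.
  have qqle : q + q <= q + q + q by rewrite lerDl ltW.
  have quot v : v != 0 -> cnorm v < dl ->
      p (cquotient g c k v - cpartial k g (z + x0 *: delta_mx 0 j)) <= e / 2.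
    move=> v0 vd; rewrite -(ler_pM2l (_ : 0 < cnorm v)) ?cnorm_gt0//.
    rewrite -csnZ scalerBr cquotientE// mulrC; apply: Hs.
      by apply: row_near_le cx0; exact: le_trans qs.
    by apply: row_near_le (chx0 v vd).
  split.
  - by apply: Ht; apply: row_near_le cx0; exact: le_trans qt.
  - by apply: Ht; apply: row_near_le (chx0 h hd).
  - rewrite (le_trans (csn_triangle _ (cpartial k g (z + x0 *: delta_mx 0 j)) _ _))//.
    rewrite [p (cpartial _ _ _ - _)]csn_distC.
    by rewrite [leRHS]splitr lerD// quot.
exists rho => // x c h h' xr; apply: (H x).
by rewrite /= cnorm_ge0.
Qed.

(** Differentiation in the direction [j] commutes with the formation of difference
    quotients in the direction [k]. Hence the difference of two such quotients of
    [cpartial j g] is the derivative of the corresponding difference for [g],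
    which is uniformly small on a disc of fixed radius [r], and Cauchy's estimate
    transfers the smallness to the derivative. *)
Lemma cquotient_cpartial_cauchy Omega g p z j k e : open Omega ->
  complex_C1 Omega g -> 0 < e -> Omega z ->
  exists2 rho, 0 < rho & forall b h h', row_near b z rho ->
    h != 0 -> h' != 0 -> cnorm h < rho -> cnorm h' < rho ->
    [/\ Omega b, Omega (b + h *: delta_mx 0 k) &
    p (cquotient (cpartial j g) b k h - cquotient (cpartial j g) b k h') <= e].
Proof.
move=> oO Hg e0 Oz; have [r0 r00 Hr0] := open_row oO Oz.
pose r := r0 / 2; have r_gt0 : 0 < r by rewrite divr_gt0.
have e1 : 0 < e * r / 2 by rewrite divr_gt0// mulr_gt0.
have [|rho rho0 H] := @cquotient_uniform_cauchy _ _ p z j k r _ oO Hg e1.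
  by move=> x xr; apply: Hr0; apply: row_near_line; rewrite /r in xr; lra.
exists rho => // b h h' bz h0 h'0 hr h'r.
have H' x v : cnorm x <= r -> v != 0 -> cnorm v < rho ->
    [/\ Omega (b + x *: delta_mx 0 j),
      Omega (b + v *: delta_mx 0 k + x *: delta_mx 0 j) &
      p (cquotient g (b + x *: delta_mx 0 j) k v -
         cquotient g (b + x *: delta_mx 0 j) k h') <= e * r / 2].
  move=> xr v0 vr; rewrite [b + _ + _]addrAC.
  exact: H (row_near_shift _ bz) v0 h'0 vr h'r.
have E0 c : c + 0 *: delta_mx 0 j = c :> 'rV[R[i]]_d by rewrite scale0r addr0.
have md0r : cnorm (0 : R[i]) <= r by rewrite cnorm0 ltW.
split.
- by have [+ _ _] := H' _ _ md0r h0 hr; rewrite E0.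
- by have [_ + _] := H' _ _ md0r h0 hr; rewrite E0.
(* phi v is the difference quotient of g with step v, along the disc in the
   direction j. *)
pose phi v (x : R[i]) := v^-1 *: (g (b + v *: delta_mx 0 k + x *: delta_mx 0 j) -
   g (b + x *: delta_mx 0 j)).
have sphi v x : v != 0 -> cnorm v < rho -> cnorm x <= r -> strict_diff p (phi v) x
    (v^-1 *: (cpartial j g (b + v *: delta_mx 0 k + x *: delta_mx 0 j) -
      cpartial j g (b + x *: delta_mx 0 j))).
  move=> v0 vr xr; have [O1 O2 _] := H' x v xr v0 vr.
  by apply: strict_diffZ; apply: strict_diffB; exact: complex_C1_strict oO Hg _.
(* The bound M in Cauchy's estimate was chosen to give back e. *)
have -> : e = 2 * (e * r / 2) / r by field; rewrite gt_eqF.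
apply: (@cauchy_estimate R F p (fun x => phi h x - phi h' x)) => //.
- by move=> x xr; eexists; apply: strict_diffB; apply: sphi.
- have := strict_diffB (sphi h 0 h0 hr md0r) (sphi h' 0 h'0 h'r md0r).
  by rewrite !E0.
- move=> x xr; have [_ _] := H' x h xr h0 hr.
  have E v : phi v x = cquotient g (b + x *: delta_mx 0 j) k v.
    by rewrite /phi (addrAC b).
  by rewrite -!E.
Qed.

Lemma csn_complete (u : R[i] -> F) : tvs_complete F ->
  (forall p e, 0 < e -> exists2 r, 0 < r & forall h h', h != 0 -> h' != 0 ->
    cnorm h < r -> cnorm h' < r -> p (u h - u h') <= e) ->
  exists l : F, u h @[h --> 0^'] --> l.
Proof.
move=> cF H; apply: cF.
rewrite /tvs_cauchy; apply/csn_cvgP => p e e0.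
have [r r0 Hr] := H p _ (divr_gt0 e0 (ltr0n _ 2)).
pose A := [set x : F | exists h, [/\ h != 0, cnorm h < r & x = u h]].
have FA : fmap u (0 : R[i])^' A.
  by apply/dnbhs_cnorm; exists r => // h h0 hr; exists h.
exists (A, A) => //= -[x y] /= [[h [h0 hr ->]] [h' [h'0 h'r ->]]].
rewrite subr0 (le_lt_trans (Hr _ _ _ _ _ _))//.
by rewrite ltr_pdivrMr// ltr_pMr// ltr1n.
Qed.

(** In a complete space, complex C^1 functions are stable under partial
    differentiation: the difference quotients of a derivative converge, locally
    uniformly with respect to the base point, so their limit is continuous. *)
Lemma complex_C1_cpartial Omega g j : tvs_complete F -> open Omega ->
  complex_C1 Omega g -> complex_C1 Omega (cpartial j g).
Proof.
move=> cF oO Hg.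
have D1 : cdiff1 Omega (cpartial j g).
  move=> z Oz k; apply: csn_complete => // p e e0.
  have [rho rho0 H] := cquotient_cpartial_cauchy p j k oO Hg e0 Oz.
  exists rho => // h h' h0 h'0 hr h'r.
  by have [] := H z h h' (row_near_refl _ rho0) h0 h'0 hr h'r.
split=> // k z Oz; apply/row_contP => p e e0.
have e40 : 0 < e / 4 by rewrite divr_gt0.
have [rho rho0 H] := cquotient_cpartial_cauchy p j k oO Hg e40 Oz.
pose h : R[i] := (rho / 2)%:C.
have h0 : h != 0 by rewrite realC_neq0// divr_gt0.
have hr : cnorm h < rho by rewrite cnorm_real gtr0_norm ?divr_gt0//; lra.
(* Let the second step tend to 0 in the Cauchy condition. *)
have lim b : row_near b z rho ->
    p (cquotient (cpartial j g) b k h - cpartial k (cpartial j g) b) <= e / 4.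
  move=> bz; have [Ob _ _] := H b h h bz h0 h0 hr hr.
  apply/ler_addgt0Pr => e1 e10.
  have [t t0 Ht] := (csn_dlimP _ _).1 (cpartialP (j := k) D1 Ob) p e1 e10.
  pose v : R[i] := (Num.min t rho / 2)%:C.
  have m0 : 0 < Num.min t rho by rewrite lt_min t0.
  have v0 : v != 0 by rewrite realC_neq0// divr_gt0.
  have : cnorm v < Num.min t rho.
    by rewrite cnorm_real gtr0_norm ?divr_gt0//; set m := Num.min _ _ in m0 *; lra.
  rewrite lt_min => /andP[vt vr]; have [_ _ Hh] := H b h v bz h0 v0 hr vr.
  rewrite (le_trans (csn_triangle _ (cquotient (cpartial j g) b k v) _ _))//.
  by rewrite lerD// ltW// Ht.
have [_ Ozh _] := H z h h (row_near_refl _ rho0) h0 h0 hr hr.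
have Hc := Hg.2.
have e5 : 0 < cnorm h * (e / 8) by rewrite mulr_gt0 ?cnorm_gt0// divr_gt0.
have [r1 r10 H1] := (row_contP _ _).1 (Hc j z Oz) p _ e5.
have [r2 r20 H2] := (row_contP _ _).1 (Hc j _ Ozh) p _ e5.
exists (Num.min rho (Num.min r1 r2)); first by rewrite !lt_min rho0 r10.
move=> w wz.
have wrho : row_near w z rho by apply: row_near_le wz; rewrite ge_min lexx.
have w1 : row_near w z r1 by apply: row_near_le wz; rewrite !ge_min lexx orbT.
have w2 : row_near w z r2 by apply: row_near_le wz; rewrite !ge_min lexx !orbT.
have {}H1 := H1 _ w1; have {}H2 := H2 _ (row_near_shift _ w2).
have Hq : p (cquotient (cpartial j g) w k h - cquotient (cpartial j g) z k h)
    <= e / 4.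
  rewrite -scalerBr csnZ cnormV mulrC ler_pdivrMr ?cnorm_gt0// subr_subrACA.
  by rewrite (le_trans (csnB _ _ _))// (le_trans (lerD (ltW H2) (ltW H1)))//; lra.
rewrite (le_lt_trans (csn_triangle _ (cquotient (cpartial j g) w k h) _ _))//.
rewrite csn_distC.
have h3 := csn_triangle p (cquotient (cpartial j g) z k h)
  (cquotient (cpartial j g) w k h) (cpartial k (cpartial j g) z).
have h5 := lim _ (row_near_refl z rho0).
rewrite (le_lt_trans (lerD (lim _ wrho) (le_trans h3 (lerD Hq h5))))//; lra.
Qed.

End Regularity.

(** * Descent from the completion *)

Lemma eventually_bounded (R : realType) (a : nat -> R) (C : R) (N : nat) :
  (forall n, (N <= n)%N -> a n <= C) -> exists C', forall n, a n <= C'.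
Proof.
elim: N C => [|N IH] C H; first by exists C => n; exact: H.
apply: (IH (Num.max C (a N))) => n; rewrite leq_eqVlt => /predU1P[<-|Nn].
  by rewrite le_max lexx orbT.
by rewrite le_max H.
Qed.

Lemma expr2V_lt (R : realType) (r : R) : 0 < r ->
  exists N, forall n, (N <= n)%N -> (2 ^+ n)^-1 < r.
Proof.
move=> r0; exists (Num.bound r^-1) => n Nn.
rewrite invf_plt ?posrE ?exprn_gt0//.
apply: lt_le_trans (archi_boundP _) _; first by rewrite invr_ge0 ltW.
by rewrite -natrX ler_nat (leq_trans Nn)// ltnW// ltn_expl.
Qed.

Section Transfer.
Context {R : realType} {E : tvsType R[i]} (Ehat : completion E).
Let kappa := cpl_inj Ehat.

Lemma cpl_csn_pullback (q : cseminorm Ehat) : exists p : cseminorm E,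
  forall x, p x = q (kappa x).
Proof.
have pD x y : q (kappa (x + y)) <= q (kappa x) + q (kappa y) by rewrite linearD csnD.
have pZ a x : q (kappa (a *: x)) = cnorm a * q (kappa x) by rewrite linearZ csnZ.
have pN e : 0 < e -> nbhs 0 [set x | q (kappa x) < e].
  move=> e0; apply/(cpl_initial Ehat); exists [set y | q y < e] => //.
  by rewrite linear0; exact: csn_nbhs.
by exists (CSeminorm pD pZ pN).
Qed.

(** The topology of [E] is the one induced by its completion. *)
Lemma cpl_csn_dominate (p : cseminorm E) : exists q : cseminorm Ehat,
  forall x, p x <= q (kappa x).
Proof.
have [V] := (cpl_initial Ehat 0 [set x | p x < 1]).1 (csn_nbhs p ltr01).
rewrite linear0 => /csn_base[q qV] Vp; exists q.
by apply: csn_dominated => x qx; apply: Vp; exact: qV.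
Qed.

Lemma cpl_csn_triangle (p : cseminorm E) (q : cseminorm Ehat) (a b : E) (c : Ehat) :
  (forall x, p x <= q (kappa x)) -> p (a - b) <= q (kappa a - c) + q (kappa b - c).
Proof.
move=> pq; rewrite (le_trans (pq _))// linearB (csn_distC q (kappa b)).
exact: csn_triangle.
Qed.

Lemma cpl_cvg (T : Type) (G : set_system T) (FG : Filter G) (u : T -> E) l :
  u x @[x --> G] --> l <-> kappa (u x) @[x --> G] --> kappa l.
Proof.
split=> H.
  apply: (iffRL (csn_cvgP (fmap_filter (fun x => kappa (u x)) FG) _)) => q e e0.
  have [p pq] := cpl_csn_pullback q.
  have := (csn_cvgP (fmap_filter _ FG) _).1 H p e e0.
  apply: (@filterS _ G FG) => x /=.
  by rewrite pq linearB.
apply: (iffRL (csn_cvgP (fmap_filter u FG) _)) => p e e0.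
have [q pq] := cpl_csn_dominate p.
have := (csn_cvgP (fmap_filter _ FG) _).1 H q e e0.
apply: (@filterS _ G FG) => x /=.
by rewrite -linearB; exact/le_lt_trans/pq.
Qed.

Context {d : nat}.
Implicit Types (f : 'rV[R[i]]_d -> E) (Omega : set 'rV[R[i]]_d).

Lemma cpl_cquotient f z j h :
  kappa (cquotient f z j h) = cquotient (kappa \o f) z j h.
Proof. by rewrite /cquotient linearZ linearB. Qed.

Lemma cpl_cquotient_cvg f z j l : cquotient f z j h @[h --> 0^'] --> l <->
  cquotient (kappa \o f) z j h @[h --> 0^'] --> kappa l.
Proof.
have -> : cquotient (kappa \o f) z j = kappa \o cquotient f z j.
  by apply/funext => h; rewrite /= cpl_cquotient.
exact: cpl_cvg.
Qed.

(** The derivative [G] of [kappa \o f] exists in the completion and is itself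
    differentiable, hence the difference quotients for the steps [2^-n] approach
    [G z] at the rate [2^-n] for every seminorm. They lie in [E], so local
    completeness provides a limit in [E], which can only be [G z]. *)
Lemma complex_C1_cquotient_cvg Omega f z j : locally_complete E -> open Omega ->
  complex_C1 Omega (kappa \o f) -> Omega z ->
  exists l : E, cquotient f z j h @[h --> 0^'] --> l.
Proof.
move=> lcE oO Hg Oz; set g := kappa \o f in Hg.
have HG := complex_C1_cpartial j (@cpl_complete _ _ Ehat) oO Hg.
set G := cpartial j g in HG.
have [r0 r00 Or] := open_row oO Oz.
pose x n := cquotient f z j ((2 ^+ n)^-1)%:C.
have hN (n : nat) : 0 < (2 ^+ n)^-1 :> R by rewrite invr_gt0 exprn_gt0.
have rate (q : cseminorm Ehat) : exists C, forall n, 2 ^+ n * q (kappa (x n) - G z) <= C.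
  have [r r_gt0 Hr] := (csn_dlimP _ _).1 (cpartialP (j := j) HG.1 Oz) q 1 ltr01.
  pose C := q (cpartial j G z) + 1.
  have C0 : 0 < C by rewrite ltr_wpDl// csn_ge0.
  have HC h : cnorm h < r -> q (G (z + h *: delta_mx 0 j) - G z) <= C * cnorm h.
    move=> hr; have [->|h0] := eqVneq h 0.
      by rewrite scale0r addr0 subrr csn0 cnorm0 mulr0.
    rewrite -cquotientE// csnZ mulrC ler_wpM2r ?cnorm_ge0//.
    rewrite -(subrK (cpartial j G z) (cquotient G z j h)).
    by rewrite (le_trans (csnD _ _ _))// addrC lerD// ltW// Hr.
  (* The mean value inequality squares the step, since G varies at most linearly. *)
  have Hq h : h != 0 -> cnorm h < r -> cnorm h < r0 ->
      q (cquotient g z j h - G z) <= C * cnorm h.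
    move=> h0 hr hr0; rewrite -(ler_pM2l (_ : 0 < cnorm h)) ?cnorm_gt0//.
    rewrite -csnZ scalerBr cquotientE// mulrC; apply: line_mean_value => t.
    move=> /andP[t0 t1].
    have mth : cnorm (t%:C * h) <= cnorm h.
      by rewrite cnormM cnorm_real ger0_norm// ler_piMl ?cnorm_ge0.
    exists (G (z + (t%:C * h) *: delta_mx 0 j)).
      apply: cpartialP Hg.1 _; apply: Or; apply: row_near_line.
      exact: le_lt_trans hr0.
    rewrite (le_trans (HC _ _))//; first exact: le_lt_trans hr.
    by rewrite ler_pM2l.
  have [N HN] := expr2V_lt r_gt0; have [N' HN'] := expr2V_lt r00.
  apply: (@eventually_bounded _ _ C (maxn N N')) => n.
  rewrite geq_max => /andP[Nn N'n].
  have m2 : cnorm (((2 ^+ n)^-1)%:C : R[i]) = (2 ^+ n)^-1 by rewrite cnorm_real gtr0_norm.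
  have := Hq ((2 ^+ n)^-1)%:C (realC_neq0 (hN n)).
  rewrite m2 => /(_ (HN _ Nn) (HN' _ N'n)).
  by rewrite -cpl_cquotient -/(x n) ler_pdivlMr ?exprn_gt0// mulrC.
have [l xl] : exists l : E, x n @[n --> \oo] --> l.
  apply: mackey_cvg lcE _ => p; have [q pq] := cpl_csn_dominate p.
  have [C HC] := rate q; exists (C + C) => m n mn.
  apply: le_trans (lerD (HC n) (HC m)).
  have h : p (x n - x m) <= q (kappa (x n) - G z) + q (kappa (x m) - G z).
    exact: cpl_csn_triangle.
  apply: (le_trans (ler_wpM2l (exprn_ge0 m (ler0n R 2)) h)).
  rewrite mulrDr; apply: lerD; last exact: lexx.
  by apply: ler_wpM2r; rewrite ?csn_ge0// ler_weXn2l// ler1n.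
have xG : kappa (x n) @[n --> \oo] --> G z.
  apply/csn_cvgP => q e e0.
  have [r r_gt0 Hr] := (csn_dlimP _ _).1 (cpartialP (j := j) Hg.1 Oz) q e e0.
  have [N HN] := expr2V_lt r_gt0; exists N => // n /= Nn.
  rewrite cpl_cquotient; apply: Hr; first exact: realC_neq0.
  by rewrite cnorm_real gtr0_norm// HN.
have lG : kappa l = G z.
  apply: (@cvg_unique _ (@cpl_hausdorff _ _ Ehat) (kappa (x n) @[n --> \oo])) => //.
  exact/cpl_cvg.
by exists l; apply/cpl_cquotient_cvg; rewrite lG; exact: cpartialP Hg.1 Oz.
Qed.

Lemma cpl_cpartial Omega f z j : cdiff1 Omega f -> Omega z ->
  cpartial j (kappa \o f) z = kappa (cpartial j f z).
Proof.
move=> Df Oz; apply: cpartial_unique; first exact: cpl_hausdorff.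
by apply/cpl_cquotient_cvg; exact: cpartialP Df Oz.
Qed.

Lemma cdiff1_cpl Omega f : cdiff1 Omega f -> cdiff1 Omega (kappa \o f).
Proof.
by move=> Df z Oz j; have [l Hl] := Df z Oz j; exists (kappa l);
  exact/cpl_cquotient_cvg.
Qed.

Lemma row_cont_ext (F : tvsType R[i]) Omega (G G' : 'rV[R[i]]_d -> F) z :
  open Omega -> (forall w, Omega w -> G w = G' w) -> Omega z ->
  {for z, continuous G} -> {for z, continuous G'}.
Proof.
move=> oO GG' Oz /row_contP H; apply/row_contP => p e e0.
have [r r0 Hr] := H p e e0; have [s s0 Hs] := open_row oO Oz.
exists (Num.min r s) => [|w wz]; first by rewrite lt_min r0.
rewrite -!GG'//; last by apply: Hs; apply: row_near_le wz; rewrite ge_min lexx orbT.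
by apply: Hr; apply: row_near_le wz; rewrite ge_min lexx.
Qed.

Lemma cpl_continuous f z : {for z, continuous f} <->
  {for z, continuous (kappa \o f)}.
Proof. exact: (cpl_cvg (nbhs_filter z) f (f z)). Qed.

Lemma complex_C1_cplP Omega f : open Omega ->
  complex_C1 Omega f <-> cdiff1 Omega f /\ complex_C1 Omega (kappa \o f).
Proof.
move=> oO; have Ef (Df : cdiff1 Omega f) j w : Omega w ->
    kappa (cpartial j f w) = cpartial j (kappa \o f) w.
  by move=> Ow; rewrite (cpl_cpartial _ Df Ow).
split=> [[Df Cf]|[Df [Dg Cg]]]; split=> //.
  split; first exact: cdiff1_cpl.
  move=> j z Oz; apply: (row_cont_ext oO (Ef Df j) Oz).
  by apply/cpl_continuous; exact: Cf.
move=> j z Oz; apply/cpl_continuous; apply: (row_cont_ext oO _ Oz (Cg j z Oz)).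
by move=> w Ow; rewrite -Ef.
Qed.

Lemma complex_C1_ext (F : tvsType R[i]) Omega (g g' : 'rV[R[i]]_d -> F) :
  hausdorff_space F -> open Omega -> (forall w, Omega w -> g w = g' w) ->
  complex_C1 Omega g -> complex_C1 Omega g'.
Proof.
move=> hF oO gg' [Dg Cg].
have lim z j (l : F) : Omega z -> cquotient g z j h @[h --> 0^'] --> l ->
    cquotient g' z j h @[h --> 0^'] --> l.
  move=> Oz /csn_dlimP H; apply/csn_dlimP => p e e0.
  have [r r0 Hr] := H p e e0; have [s s0 Hs] := open_row oO Oz.
  exists (Num.min r s) => [|h h0]; first by rewrite lt_min r0.
  rewrite lt_min => /andP[hr hs]; rewrite /cquotient -!gg'//; first exact: Hr.
  by apply: Hs; exact: row_near_line.
have D' : cdiff1 Omega g'.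
  by move=> z Oz j; have [l Hl] := Dg z Oz j; exists l; exact: lim.
split=> // j z Oz; apply: (row_cont_ext oO _ Oz (Cg j z Oz)) => w Ow.
by apply/esym/cpartial_unique => //; apply: lim => //; exact: cpartialP Dg Ow.
Qed.

(** [kappa \o f] is complex C^1, hence so are its partial derivatives in the
    completion; the latter are the images of those of [f], and one iterates. *)
Lemma complex_C1_cdiff Omega f k : locally_complete E -> open Omega ->
  complex_C1 Omega (kappa \o f) -> cdiff k Omega f.
Proof.
move=> lcE oO; elim: k f => //= k IH f Hg.
have Df : cdiff1 Omega f.
  by move=> z Oz j; exact: (complex_C1_cquotient_cvg j lcE oO Hg Oz).
split=> // j; apply: IH.
apply: (@complex_C1_ext _ _ (cpartial j (kappa \o f))) => //; first exact: cpl_hausdorff.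
  by move=> w Ow; rewrite (cpl_cpartial _ Df Ow).
exact: complex_C1_cpartial j (@cpl_complete _ _ Ehat) oO Hg.
Qed.

End Transfer.

(** * Real and complex partial derivatives *)

Section RealPartials.
Context {R : realType} {d : nat}.

Lemma nbhs_rrow n (x : 'rV[R]_n) (P : set 'rV[R]_n) :
  nbhs x P <-> exists2 r : R, 0 < r &
    forall y : 'rV[R]_n, (forall i, `|y 0 i - x 0 i| < r) -> P y.
Proof.
split.
  move=> /nbhs_ballP[r /= r0 H]; exists r => // y yx; apply: H.
  split=> [//|i j]; rewrite ord1 -ball_normE /ball_ /= distrC; exact: yx.
move=> [r r0 H]; apply/nbhs_ballP; exists r => //= y [_ yx]; apply: H => j.
by have := yx 0 j; rewrite -ball_normE /ball_ /= distrC.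
Qed.

(** The complex direction of the real variable with index [(j, b)]: a real part for
    [b = 0], an imaginary part for [b = 1]. *)
Definition axis_direction (b : 'I_2) : R[i] := if b == 0 then 1 else 'i.

Lemma cnorm_i : cnorm ('i : R[i]) = 1.
Proof. by rewrite /cnorm /= expr0n expr1n add0r sqrtr1. Qed.

Lemma cnorm_axis_direction b : cnorm (axis_direction b) = 1.
Proof. by rewrite /axis_direction; case: ifP; rewrite ?cnorm1 ?cnorm_i. Qed.

Lemma phi_inv_line (x : 'rV[R]_(d * 2)) j b (t : R) :
  phi_inv (x + t *: delta_mx 0 (mxvec_index j b)) =
  phi_inv x + (t%:C * axis_direction b) *: delta_mx 0 j :> 'rV[R[i]]_d.
Proof.
apply/rowP => k; rewrite [LHS]mxE linearD linearZ /= vec_mx_delta !mxE eqxx/=.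
have [->|kj] := eqVneq k j; last by rewrite !mulr0 !addr0.
have [->|b1] := eqVneq b 0.
  rewrite /axis_direction eqxx !mulr1 (_ : (1 == 0 :> 'I_2) = false)//= mulr0 addr0.
  by simpc.
have -> : b = 1.
  by apply/val_inj; case: b b1 => -[|[|[]]] //= b2 /eqP.
by rewrite /axis_direction /= !mulr1 mulr0 addr0; simpc.
Qed.

Lemma phi_inv_near (x y : 'rV[R]_(d * 2)) r :
  (forall i, `|y 0 i - x 0 i| < r / 2) -> row_near (phi_inv y) (phi_inv x) r.
Proof.
move=> yx j; rewrite !mxE.
set a := y 0 _; set b := y 0 _; set a' := x 0 _; set b' := x 0 _.
rewrite (_ : _ - _ = (a - a')%:C + 'i * (b - b')%:C); last by simpc.
rewrite (le_lt_trans (cnormD _ _))// cnormM cnorm_i mul1r !cnorm_real.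
by rewrite [ltRHS]splitr ltrD// yx.
Qed.

Lemma phi_near (z w : 'rV[R[i]]_d) r : row_near w z r ->
  forall i, `|phi w 0 i - phi z 0 i| < r.
Proof.
move=> wz i; case/mxvec_indexP: i => j b; rewrite /phi !mxvecE !mxE.
apply: le_lt_trans (wz j); case: (w 0 j) => a a'; case: (z 0 j) => c c' /=.
by case: ifP => _; [exact: (Re_le_cnorm ((a - c) +i* (a' - c')))|
                    exact: (Im_le_cnorm ((a - c) +i* (a' - c')))].
Qed.

Context {E : tvsType R[i]}.
Implicit Types (f : 'rV[R[i]]_d -> E) (Omega : set 'rV[R[i]]_d).

(** A real difference quotient is a complex one with the step rotated by 1 or [i]. *)
Lemma rquotient_cvg f x j b (l : E) :
  cquotient f (phi_inv x) j h @[h --> 0^'] --> l ->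
  rquotient (f \o phi_inv) x (mxvec_index j b) t @[t --> 0^'] --> axis_direction b *: l.
Proof.
move=> /csn_dlimP H; apply/csn_cvgP => p e e0; have [r r0 Hr] := H p e e0.
apply/nbhs_normP; exists r => //= t; rewrite /ball_ /= sub0r normrN => tr t0.
have tC0 : t%:C != 0 :> R[i].
  by rewrite -cnorm_gt0 cnorm_real normr_gt0.
have b0 : axis_direction b != 0 by rewrite -cnorm_gt0 cnorm_axis_direction.
have -> : rquotient (f \o phi_inv) x (mxvec_index j b) t =
    axis_direction b *: cquotient f (phi_inv x) j (t%:C * axis_direction b).
  rewrite /rquotient /cquotient /= phi_inv_line scalerA; congr (_ *: _).
  by field; rewrite tC0 b0.
rewrite -scalerBr csnZ cnorm_axis_direction mul1r; apply: Hr; first by rewrite mulf_neq0.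
by rewrite cnormM cnorm_real cnorm_axis_direction mulr1.
Qed.

Lemma rpartialE f x j b (l : E) : hausdorff_space E ->
  cquotient f (phi_inv x) j h @[h --> 0^'] --> l ->
  rpartial (mxvec_index j b) (f \o phi_inv) x = axis_direction b *: l.
Proof.
move=> hE /(@rquotient_cvg _ _ _ b) H; rewrite /rpartial.
case: xgetP => [m _ Hm|/(_ (axis_direction b *: l))//].
exact: (@cvg_unique _ hE _ _ _ _ Hm H).
Qed.

Lemma complex_C1_C1_real Omega f : hausdorff_space E -> complex_C1 Omega f ->
  C1_real Omega f.
Proof.
move=> hE [Df Cf] i; case/mxvec_indexP: i => j b; split.
  move=> _ [z Oz <-]; have [l Hl] := Df z Oz j.
  by exists (axis_direction b *: l); apply: rquotient_cvg; rewrite phiK.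
apply/subspace_continuousP => _ [z Oz <-].
have rE w : Omega w -> rpartial (mxvec_index j b) (f \o phi_inv) (phi w) =
    axis_direction b *: cpartial j f w.
  by move=> Ow; apply: rpartialE => //; rewrite phiK; exact: cpartialP Df Ow.
apply: (iffRL (csn_cvgP (fmap_filter _ (within_filter _ (nbhs_filter _))) _)).
move=> p e e0; have [r r0 Hr] := (row_contP _ _).1 (Cf j z Oz) p e e0.
apply/nbhs_rrow; exists (r / 2); first by rewrite divr_gt0.
move=> y yx [w Ow wE]; move: yx; rewrite -wE => yx.
rewrite /from_subspace /= !rE// -scalerBr csnZ cnorm_axis_direction mul1r; apply: Hr.
by have := phi_inv_near yx; rewrite !phiK.
Qed.

(** The derivative with respect to the real part of the [j]th variable is the complex
    partial derivative, so its continuity suffices. *)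
Lemma C1_real_complex_C1 Omega f : hausdorff_space E -> open Omega ->
  cdiff1 Omega f -> C1_real Omega f -> complex_C1 Omega f.
Proof.
move=> hE oO Df Cf; split=> // j z Oz; apply/row_contP => p e e0.
have [_ /subspace_continuousP] := Cf (mxvec_index j 0).
move=> /(_ (phi z)) /(_ (imageP _ Oz)).
move=> /(csn_cvgP (fmap_filter _ (within_filter _ (nbhs_filter _)))).
move=> /(_ p e e0)/nbhs_rrow[r r0 Hr].
have [s s0 Hs] := open_row oO Oz.
have rE w : Omega w -> rpartial (mxvec_index j 0) (f \o phi_inv) (phi w) =
    cpartial j f w.
  move=> Ow; rewrite (@rpartialE f (phi w) j 0 (cpartial j f w))// ?scale1r//.
  by rewrite phiK; exact: cpartialP Df Ow.
exists (Num.min r s) => [|w wz]; first by rewrite lt_min r0.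
have Ow : Omega w by apply: Hs; apply: row_near_le wz; rewrite ge_min lexx orbT.
have wr : row_near w z r by apply: row_near_le wz; rewrite ge_min lexx.
by have := Hr (phi w) (phi_near wr) (imageP _ Ow); rewrite /from_subspace /= !rE.
Qed.

End RealPartials.

(** * Differentiability in the completion *)

Section Frechet.
Context {R : realType} {d : nat} {E : tvsType R[i]} (Ehat : completion E).
Implicit Types (f : 'rV[R[i]]_d -> E) (Omega : set 'rV[R[i]]_d).

Lemma cnorm_le_enorm (v : 'rV[R[i]]_d) j : cnorm (v 0 j) <= cnorm (enorm v).
Proof.
have s0 : 0 <= \sum_j `|v 0 j| ^+ 2 by apply: sumr_ge0 => k _; rewrite exprn_ge0.
rewrite -lecR -!normr_cnorm [leRHS]ger0_norm ?sqrtC_ge0//.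
rewrite -[leLHS](@sqrCK _) ?normr_ge0// ler_sqrtC ?nnegrE ?exprn_ge0//.
by rewrite (bigD1 j)//= lerDl sumr_ge0// => k _; rewrite exprn_ge0.
Qed.

Lemma enorm_delta (h : R[i]) j : enorm (h *: delta_mx 0 j : 'rV[R[i]]_d) = `|h|.
Proof.
rewrite /enorm (bigD1 j)//= big1 => [|k kj]; last first.
  by rewrite !mxE (negbTE kj) mulr0 normr0 expr0n.
by rewrite !mxE !eqxx mulr1 addr0 sqrCK ?normr_ge0.
Qed.

Lemma holomorphic_complex_C1 Omega f : open Omega -> holomorphic Ehat Omega f ->
  complex_C1 Omega (cpl_inj Ehat \o f).
Proof.
move=> oO [df [Hdf Cdf]].
have lim z j : Omega z -> cquotient (cpl_inj Ehat \o f) z j h @[h --> 0^'] -->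
    df z (delta_mx 0 j).
  move=> Oz; apply/csn_dlimP => q e e0.
  have := (csn_cvgP (fmap_filter _ (within_filter _ (dnbhs_filter _))) _).1
    (Hdf z Oz) q e e0.
  move=> /nbhs_row[r r0 Hr]; have [s s0 Hs] := open_row oO Oz.
  exists (Num.min r s) => [|h h0]; first by rewrite lt_min r0.
  rewrite lt_min => /andP[hr hs].
  have := Hr _ (row_near_line z j hr).
  have zh : z + h *: delta_mx 0 j != z.
    rewrite -subr_eq0 addrAC subrr add0r; apply/eqP => /rowP/(_ j)/eqP.
    by rewrite !mxE !eqxx mulr1 (negbTE h0).
  move=> /(_ zh (Hs _ (row_near_line z j hs))) /=.
  have qE : h *: (cquotient (cpl_inj Ehat \o f) z j h - df z (delta_mx 0 j)) =
      cpl_inj Ehat (f (z + h *: delta_mx 0 j)) - cpl_inj Ehat (f z) -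
      df z (h *: delta_mx 0 j).
    by rewrite scalerBr cquotientE// [df z (h *: _)]linearZ.
  have zhz : z + h *: delta_mx 0 j - z = h *: delta_mx 0 j.
    by rewrite addrAC subrr add0r.
  rewrite zhz enorm_delta subr0 csnZ cnormV normr_cnorm cnorm_real ger0_norm ?cnorm_ge0//.
  by rewrite -qE csnZ mulKf// cnorm_eq0.
have D : cdiff1 Omega (cpl_inj Ehat \o f).
  by move=> z Oz j; exists (df z (delta_mx 0 j)); exact: lim.
split=> // j z Oz; apply: (row_cont_ext oO _ Oz (G := fun z => df z (delta_mx 0 j))).
  by move=> w Ow; apply/esym/cpartial_unique; [exact: cpl_hausdorff|exact: lim].
apply/row_contP => q e e0.
have /subspace_continuousP/(_ z Oz) := Cdf (delta_mx 0 j).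
move=> /(csn_cvgP (fmap_filter _ (within_filter _ (nbhs_filter _)))).
move=> /(_ q e e0)/nbhs_row[r r0 Hr]; have [s s0 Hs] := open_row oO Oz.
exists (Num.min r s) => [|w wz]; first by rewrite lt_min r0.
apply: Hr; first by apply: row_near_le wz; rewrite ge_min lexx.
by apply: Hs; apply: row_near_le wz; rewrite ge_min lexx orbT.
Qed.

(** The differential is the linear form with the partial derivatives as
    coefficients. The error estimate in terms of the sum of the moduli of the
    coordinates is at most [d] times the one in terms of the Euclidean norm. *)
Lemma complex_C1_holomorphic Omega f : open Omega ->
  complex_C1 Omega (cpl_inj Ehat \o f) -> holomorphic Ehat Omega f.
Proof.
move=> oO Hg; set g := cpl_inj Ehat \o f in Hg.
pose D z (v : 'rV[R[i]]_d) : Ehat := \sum_j v 0 j *: cpartial j g z.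
have D_lin z : linear (D z).
  move=> a u v; rewrite /D scaler_sumr -big_split/=; apply: eq_bigr => j _.
  by rewrite !mxE scalerDl scalerA.
pose df z : {linear 'rV[R[i]]_d -> Ehat} :=
  HB.pack (D z) (GRing.isLinear.Build _ _ _ _ (D z) (D_lin z)).
exists df; split => [z Oz|v].
  apply: (iffRL (csn_cvgP (fmap_filter _ (within_filter _ (dnbhs_filter _))) _)).
  move=> q e e0; have d0 : 0 < 1 + d%:R :> R by rewrite ltr_pwDl.
  have [r r0 Hr] := complex_C1_total q oO Hg Oz (divr_gt0 e0 d0).
  apply/nbhs_row; exists r => // w wz wnz Ow.
  have := Hr z w (row_near_refl z r0) wz.
  set S := \sum_j cnorm _ => Hq.
  have wz0 : 0 < cnorm (enorm (w - z)).
    rewrite lt_def cnorm_ge0 andbT; apply: contra wnz => /eqP e_0.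
    apply/eqP/rowP => j; apply/eqP; rewrite -subr_eq0 -cnorm_eq0 eq_le cnorm_ge0 andbT.
    by rewrite -e_0; have := cnorm_le_enorm (w - z) j; rewrite !mxE.
  have Sle : S <= d%:R * cnorm (enorm (w - z)).
    rewrite mulr_natl -[X in _ *+ X]card_ord -sumr_const; apply: ler_sum => j _.
    by have := cnorm_le_enorm (w - z) j; rewrite !mxE.
  rewrite /= subr0 csnZ cnormV mulrC ltr_pdivrMr//.
  have -> : D z (w - z) = \sum_j (w 0 j - z 0 j) *: cpartial j g z.
    by apply: eq_bigr => j _; rewrite !mxE.
  apply: (le_lt_trans Hq); rewrite mulrAC ltr_pdivrMr// -mulrA ltr_pM2l//.
  by rewrite mulrDr mulr1 mulrC; rewrite mulrC in Sle; lra.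
apply/subspace_continuousP => z Oz.
apply: cvg_within_filter.
rewrite /df /=.
apply: (iffRL (row_contP _ _)) => q e e0.
have K0 : 0 < \sum_j (cnorm (v 0 j) + 1) + 1.
  by rewrite ltr_wpDl// sumr_ge0// => j _; rewrite addr_ge0 ?cnorm_ge0.
set K := _ + 1 in K0.
have /choice[rr Hrr] j : exists r, 0 < r /\ forall w, row_near w z r ->
    q (cpartial j g w - cpartial j g z) < e / K.
  have [r r0 Hr] := (row_contP _ _).1 (Hg.2 j z Oz) q _ (divr_gt0 e0 K0).
  by exists r.
exists (\big[Num.min/1]_j rr j) => [|w wz].
  by apply/bigmin_gtP; split => // j _; have [] := Hrr j.
rewrite /D -sumrB (le_lt_trans (csn_sum _ _ _ _))//.
apply: (@le_lt_trans _ _ (\sum_j (e / K) * (cnorm (v 0 j) + 1))).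
  apply: ler_sum => j _; rewrite -scalerBr csnZ mulrC.
  apply: ler_pM; rewrite ?csn_ge0 ?cnorm_ge0 ?lerDl// ltW//.
  by apply: (Hrr j).2; apply: row_near_le wz; exact: bigmin_le_cond.
rewrite -mulr_sumr mulrAC ltr_pdivrMr// ltr_pM2l// /K; lra.
Qed.

End Frechet.

Theorem corollary5p8 (R : realType) (d : nat) (hd : (0 < d)%N)
    (E : tvsType R[i]) (hE : exists x : E, x <> 0)
    (hausE : hausdorff_space E) (lcE : locally_complete E)
    (Ehat : completion E)
    (Omega : set 'rV[R[i]]_d) (openOmega : open Omega)
    (f : 'rV[R[i]]_d -> E) :
  holomorphic Ehat Omega f <-> O_space Omega f.
Proof.
split.
  move=> /(holomorphic_complex_C1 openOmega) Hg.
  have Hcd k := complex_C1_cdiff k lcE openOmega Hg.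
  split=> //; apply: complex_C1_C1_real => //.
  by apply/(complex_C1_cplP Ehat) => //; split=> //; have [] := Hcd 1%N.
move=> [C1f /(_ 1%N)[Df _]]; apply: complex_C1_holomorphic => //.
by apply: (proj2 ((complex_C1_cplP Ehat f openOmega).1 _)); exact: C1_real_complex_C1.
Qed.
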